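(* Assume that $D$ is strictly convex. Let $(x_0,y_0)\in\mathcal{M}(p)\setminus\mathcal{M}_g(p)$ and assume that the Weingarten map $\mathcal{A}_{\partial\Omega,y_0}$ of $\partial\Omega$ at $y_0$ satisfies $$\mathcal{A}_{\partial\Omega,y_0}<\frac{1}{l(p,D)}I.$$ Then $(x_0,y_0)$ is a non-degenerate critical point of $l_p$ on $\partial D\times\partial\Omega$.
   Context: Setting. $\Omega\subset\mathbb{R}^3$ is a bounded domain with $C^2$ boundary; $D$ is an open subset of $\Omega$ with $C^2$ boundary such that $\overline D\subset\Omega$ and $\Omega\setminus\overline D$ is connected; $p\in\mathbb{R}^3\setminus\overline\Omega$. $\nu_x$ ($x\in\partial D$) and $\nu_y$ ($y\in\partial\Omega$) are the unit outward normals of $D$ and $\Omega$. $l_p(x,y)=|p-x|+|x-y|$, $l(p,D)=\inf_{(x,y)\in\partial D\times\partial\Omega}l_p(x,y)$, $\mathcal{M}(p)=\{(x,y)\in\partial D\times\partial\Omega:l_p(x,y)=l(p,D)\}$, $\mathcal{M}_g(p)=\{(x,y)\in\mathcal{M}(p):\nu_x\cdot(p-x)=0\}$. Weingarten map. For a $C^2$ surface $S\subset\mathbb{R}^3$ bounding a bounded open set, with unit outward normal $\nu$, $\mathcal{A}_{S,x}:T_x(S)\to T_x(S)$ is the (self-adjoint) linear map $\mathcal{A}_{S,x}(v)=D_v\nu$; so $\mathcal{A}_{S,x}=(1/R)I$ for a sphere of radius $R$. Inequalities between such maps are in the sense of quadratic forms on the tangent space. *)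

(* Defs.v *)
From mathcomp Require Export all_boot all_order all_algebra.
From mathcomp Require Export all_classical all_reals all_analysis.

Set Implicit Arguments.
Unset Strict Implicit.
Unset Printing Implicit Defensive.

Import Order.TTheory GRing.Theory Num.Theory.
Import numFieldNormedType.Exports.

Local Open Scope classical_set_scope.
Local Open Scope ring_scope.

(* The norm that the library puts on 'rV[R]_n is the sup norm: it is used below
   for the topology and for derivatives only; lengths and angles are Euclidean. *)
Definition dot (R : realType) (n : nat) (u v : 'rV[R]_n) : R :=
  \sum_(i < n) u ord0 i * v ord0 i.

Definition enorm (R : realType) (n : nat) (u : 'rV[R]_n) : R :=
  Num.sqrt (dot u u).

Definition boundary (T : topologicalType) (A : set T) : set T :=
  closure A `\` interior A.

Definition strictly_convex (R : realType) (V : normedModType R) (A : set V) :=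
  forall x y : V, closure A x -> closure A y -> x <> y ->
  forall t : R, 0 < t < 1 -> interior A (t *: x + (1 - t) *: y).

(* C^1 and C^2 through directional derivatives; in finite dimension this is
   the usual notion (existence and continuity of the partial derivatives). *)
Definition C1_at (R : realType) (V W : normedModType R) (f : V -> W) (x : V) :=
  \forall z \near x, {for z, continuous f} /\
    forall v : V, derivable f z v /\ {for z, continuous (fun y => 'D_v f y)}.

Definition C2_at (R : realType) (V W : normedModType R) (f : V -> W) (x : V) :=
  C1_at f x /\ forall v : V, C1_at (fun y => 'D_v f y) x.

(* Near each boundary point, U is the strict sublevel set at 0 of a C^2
   function with nonzero differential at that point. *)
Definition C2_boundary (R : realType) (V : normedModType R) (U : set V) :=
  forall z : V, boundary U z ->
  exists rho : V -> R^o,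
    [/\ C2_at rho z,
        exists v : V, 'D_v rho z != 0 &
        \forall w \near z, U w <-> rho w < 0].

Definition curve_through (R : realType) (V : normedModType R) (S : set V)
    (x v : V) (c : R^o -> V) :=
  [/\ c 0 = x, \forall t \near (0 : R^o), S (c t) & is_derive (0 : R^o) 1 c v].

Definition tangent_space (R : realType) (V : normedModType R) (S : set V)
    (x : V) : set V :=
  [set v | exists c : R^o -> V, curve_through S x v c].

(* D_v F for F defined on a surface S and v tangent to S at x: the common value
   of (F \o c)'(0) over the curves c in S through x with velocity v.
   Meaningless if v is not tangent, or if F is not differentiable along S. *)
Definition surface_derive (R : realType) (n : nat) (V : normedModType R)
    (S : set V) (F : V -> 'rV[R]_n) (x v : V) : 'rV[R]_n :=
  get [set w | forall c : R^o -> V, curve_through S x v c ->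
                 is_derive (0 : R^o) 1 (F \o c) w].

Definition is_outward_normal (R : realType) (n : nat) (U : set 'rV[R]_n)
    (x nu : 'rV[R]_n) :=
  [/\ enorm nu = 1,
      forall v, tangent_space (boundary U) x v -> dot nu v = 0 &
      \forall t \near 0^'+, ~ closure U (x + t *: nu)].

(* There is exactly one outward normal when x is on a C^2 boundary. *)
Definition outward_normal (R : realType) (n : nat) (U : set 'rV[R]_n)
    (x : 'rV[R]_n) : 'rV[R]_n :=
  get (is_outward_normal U x).

(* To be applied to v tangent to boundary U at x only. *)
Definition weingarten (R : realType) (n : nat) (U : set 'rV[R]_n)
    (x v : 'rV[R]_n) : 'rV[R]_n :=
  surface_derive (boundary U) (outward_normal U) x v.

(* The quadratic form inequality A < k I on the tangent space at x. *)
Definition weingarten_lt (R : realType) (n : nat) (U : set 'rV[R]_n)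
    (x : 'rV[R]_n) (k : R) :=
  forall v, tangent_space (boundary U) x v -> v <> 0 ->
    dot (weingarten U x v) v < k * dot v v.

(* Inverse of a C^2 chart of the k-dimensional submanifold M, centred at z:
   an immersion at 0 that maps neighbourhoods of 0 onto neighbourhoods of z
   in M. *)
Definition local_parametrization (R : realType) (k : nat)
    (V : normedModType R) (M : set V) (z : V) (phi : 'rV[R]_k.+1 -> V) :=
  [/\ phi 0 = z,
      C2_at phi 0,
      forall u, 'D_u phi 0 = 0 -> u = 0,
      \forall u \near (0 : 'rV[R]_k.+1), M (phi u) &
      forall N, nbhs (0 : 'rV[R]_k.+1) N -> within M (nbhs z) (phi @` N)].

(* In every local parametrization the first derivative vanishes and the
   Hessian, as a bilinear form, has trivial radical. *)
Definition nondegenerate_critical_point (R : realType) (k : nat)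
    (V : normedModType R) (M : set V) (f : V -> R) (z : V) :=
  M z /\
  forall phi : 'rV[R]_k.+1 -> V, local_parametrization M z phi ->
    let g : 'rV[R]_k.+1 -> R^o := f \o phi in
    [/\ C2_at g 0,
        forall u, 'D_u g 0 = 0 &
        forall u, (forall v, 'D_u (fun w => 'D_v g w) 0 = 0) -> u = 0].

Definition path_length (R : realType) (p : 'rV[R]_3)
    (z : 'rV[R]_3 * 'rV[R]_3) : R :=
  enorm (p - z.1) + enorm (z.1 - z.2).

Definition shortest_length (R : realType) (Omega D : set 'rV[R]_3)
    (p : 'rV[R]_3) : R :=
  inf (path_length p @` (boundary D `*` boundary Omega)).

Definition shortest_paths (R : realType) (Omega D : set 'rV[R]_3)
    (p : 'rV[R]_3) : set ('rV[R]_3 * 'rV[R]_3) :=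
  [set z | (boundary D `*` boundary Omega) z /\
           path_length p z = shortest_length Omega D p].

Definition grazing_paths (R : realType) (Omega D : set 'rV[R]_3)
    (p : 'rV[R]_3) : set ('rV[R]_3 * 'rV[R]_3) :=
  [set z | shortest_paths Omega D p z /\
           dot (outward_normal D z.1) (p - z.1) = 0].

(* Main.v *)
(* Write x0 - p and y0 - x0 as multiples r, s of unit vectors; y0 is the point of
   the outer boundary nearest to x0, so e = (y0 - x0) / s is the outward normal
   there. Minimality in x and the absence of grazing leave two cases: the path
   is straight at x0, or it is reflected on the outer side of D. In both, since
   D lies on one side of its tangent plane at x0, the point p' = x0 - r e (the
   mirror image of p in the reflected case, p itself in the straight one)
   satisfies |p' - x| <= |p - x| for x in the closure of D. Hence l_p >= l_p'
   on the surfaces, with equality at (x0, y0), and it is enough that the Hessian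
   of l_p' be positive definite. Now p', x0, y0 are aligned, so the acceleration
   of x drops out, and along a curve with velocity (a, b) the second derivative
   is Q a / r + Q (b - a) / s - A(b, b), where Q v = |v|^2 - (e.v)^2 and A is the
   Weingarten form at y0. It is at least |b|^2 / (r + s) - A(b, b) > 0 if b <> 0,
   and Q a (1 / r + 1 / s) > 0 if b = 0, since e is transversal to the
   boundary of D. *)
Require Import Defs.
From mathcomp Require Import all_boot all_order all_algebra.
From mathcomp Require Import all_classical all_reals all_analysis.
From HB Require Import structures.
From mathcomp Require Import ring lra.
Import Order.TTheory GRing.Theory Num.Theory.
Import numFieldNormedType.Exports.
Local Open Scope classical_set_scope.
Local Open Scope ring_scope.

Set Implicit Arguments.
Unset Strict Implicit.
Unset Printing Implicit Defensive.

(** * Rules for directional derivatives *)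

Section Derivatives.
Context {R : realType}.
Implicit Types V W : normedModType R.

(** Both difference quotients are the same function of the increment. This transfers directional
    derivatives to functions of a real variable, where the mean value theorem applies. *)
Lemma is_derive_line V W (f : V -> W) (x v : V) (t : R) :
  derivable f (x + t *: v) v ->
  is_derive (t : R^o) 1 (fun s : R^o => f (x + s *: v)) ('D_v f (x + t *: v)).
Proof.
move=> fv; have E : (fun h : R => h^-1 *: (((fun s : R^o => f (x + s *: v)) \o shift t) (h *: 1)
     - f (x + t *: v))) = (fun h => h^-1 *: ((f \o shift (x + t *: v)) (h *: v) - f (x + t *: v))).
  apply/funext => h /=; rewrite [_%:A]mulr1 scalerDl.
  by rewrite addrCA.
by apply: DeriveDef; rewrite /derivable /derive E.
Qed.

Lemma is_derive_comp_differentiable V W (c : R^o -> V) (F : V -> W) (t : R^o) (v : V) :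
  is_derive t 1 c v -> differentiable F (c t) ->
  is_derive t 1 (F \o c) ('D_v F (c t)).
Proof.
move=> [/derivable1_diffP dc cv] dF.
have dFc : differentiable (F \o c) t by exact: differentiable_comp.
apply: DeriveDef; first exact/diff_derivable.
rewrite deriveE// diff_comp//=; rewrite deriveE// in cv. by rewrite cv deriveE.
Qed.

(** Here [f] is only known to be derivable along [v], so the rule is drawn from the one-variable
    chain rule by restricting [f] to the line through [x] directed by [v]. *)
Lemma is_derive_comp1 V (f : V -> R) (h : R -> R) (x v : V) (df dh : R) :
  is_derive x v f df -> is_derive (f x) 1 h dh ->
  is_derive x v (h \o f) (dh * df).
Proof.
move=> dfx dhx.
have lineE (k : V -> R) : derivable k x v ->
    'D_1 (fun s : R => k (s *: v + x)) 0 = 'D_v k x.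
  move=> dk; rewrite (_ : (fun s : R => _) = (fun s : R => k (x + s *: v))).
    have /= L := @is_derive_line V R k x v 0.
    by rewrite scale0r addr0 in L; have [_ /= ->] := L dk.
  by apply/funext => s; rewrite addrC.
have dl : derivable (fun s : R => f (s *: v + x)) 0 1.
  have dfv : derivable f x v by [].
  exact (proj1 (derivable1P f x v) dfv).
have [_ dfE] := dfx.
have dL : is_derive (0 : R) (1 : R) (fun s : R => f (s *: v + x)) df.
  by apply: DeriveDef; [exact dl | rewrite lineE; [exact dfE | case: dfx]].
have dhL : is_derive (f (0 *: v + x)) (1 : R) h dh.
  by rewrite scale0r add0r; exact dhx.
have [dhf hfE] := is_derive1_comp dhL dL.
have dhf' : derivable (h \o f) x v.
  apply/derivable1P; exact dhf.
apply: DeriveDef; first exact dhf'.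
rewrite -lineE; first exact hfE.
exact dhf'.
Qed.

Lemma is_derive_entry V m n (F : V -> 'M[R]_(m, n)) (x v : V) dF i j :
  is_derive x v F dF -> is_derive x v (fun y => F y i j) (dF i j).
Proof.
move=> [dfx <-]; apply: DeriveDef; first by have /derivable_mxP := dfx.
by rewrite derive_mx// mxE.
Qed.

Lemma is_derive_row V n (F : V -> 'rV[R]_n) (x v : V) (dF : 'rV[R]_n) :
  (forall i, is_derive x v (fun y => F y ord0 i) (dF ord0 i)) ->
  is_derive x v F dF.
Proof.
move=> H; have dFx : derivable F x v.
  by apply/derivable_mxP => i j; rewrite ord1; apply: ex_derive.
apply: DeriveDef => //; rewrite derive_mx//; apply/rowP => i.
by rewrite mxE derive_val.
Qed.

Lemma is_derive_dot V n (F G : V -> 'rV[R]_n) (x v : V) dF dG :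
  is_derive x v F dF -> is_derive x v G dG ->
  is_derive x v (fun y => dot (F y) (G y)) (dot dF (G x) + dot (F x) dG).
Proof.
move=> HF HG; rewrite /dot.
have -> : (fun y => \sum_(i < n) F y ord0 i * G y ord0 i) =
    \sum_(i < n) ((fun y => F y ord0 i : R) * (fun y => G y ord0 i : R)).
  by apply/funext => y; rewrite fct_sumE.
apply: is_derive_eq; first by apply: is_derive_sum => i; apply: is_deriveM; exact: is_derive_entry.
rewrite -big_split/=; apply: eq_bigr => i _.
by rewrite /GRing.scale/= addrC; congr (_ + _); rewrite mulrC.
Qed.

Lemma is_derive_sqrt V (f : V -> R) (x v : V) (df : R) : 0 < f x ->
  is_derive x v f df ->
  is_derive x v (fun y => Num.sqrt (f y)) ((2 * Num.sqrt (f x))^-1 * df).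
Proof.
move=> f0 fx; apply: (@is_derive_comp1 _ f Num.sqrt) => //.
exact: is_derive1_sqrt.
Qed.

Lemma is_derive_inv V (f : V -> R) (x v : V) (df : R) : f x != 0 ->
  is_derive x v f df ->
  is_derive x v (fun y => (f y)^-1) (- (f x) ^- 2 * df).
Proof.
move=> f0 [fx <-]; apply: DeriveDef; first exact: derivableV.
exact: deriveV.
Qed.

End Derivatives.

(** * Functions of class C^1 and C^2 *)

Section ContinuousDifferentiability.
Context {R : realType}.
Implicit Types V W X : normedModType R.

Lemma near_eq_continuous_at (T U : topologicalType) (f g : T -> U) (x : T) :
  (\forall y \near x, f y = g y) -> {for x, continuous f} ->
  {for x, continuous g}.
Proof.
move=> fg cf; have fgx := nbhs_singleton fg.
by rewrite /prop_for /continuous_at -fgx; apply: cvg_trans (near_eq_cvg fg) cf.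
Qed.

(** Continuity of ['D_v f] at a point [z] involves its values around [z]. Since the formula [df v]
    holds on a whole neighbourhood of [x], it also holds around each [z] near [x] ([near_join]), and
    continuity passes from [df v] to ['D_v f]. *)
Lemma C1_atI V W (f : V -> W) (df : V -> V -> W) (x : V) :
  (\forall z \near x, {for z, continuous f} /\
     forall v, is_derive z v f (df v z) /\ {for z, continuous (df v)}) ->
  C1_at f x.
Proof.
move=> /near_join; apply: filterS => z Hz.
have [cf dfz] := nbhs_singleton Hz; split=> // v.
have [dfv cdf] := dfz v; split; first exact: ex_derive.
apply: near_eq_continuous_at cdf; apply: filterS Hz => y [_ /(_ v)[dy _]].
by rewrite (@derive_val _ _ _ _ _ _ _ dy).
Qed.

(** Functions that agree near a point have the same derivatives there, so the regularity of the
    formula [df v] is inherited by ['D_v f]. *)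
Lemma C2_atI V W (f : V -> W) (df : V -> V -> W) (x : V) :
  C1_at f x -> (forall v, \forall z \near x, 'D_v f z = df v z) ->
  (forall v, C1_at (df v) x) -> C2_at f x.
Proof.
move=> cf E cdf; split=> // v; apply: (@C1_atI _ _ _ (fun u => 'D_u (df v))).
have := near_join (E v); move: (cdf v) => /near_join; apply: filterS2 => z Cz Ez.
have [cz dz] := nbhs_singleton Cz.
have Ez' : \forall y \near z, df v y = 'D_v f y by apply: filterS Ez.
split; first exact: near_eq_continuous_at cz.
move=> u; have [du cu] := dz u; split=> //.
apply: (near_eq_is_derive Ez'); exact: DeriveDef.
Qed.

Lemma C1_at_near V W (f : V -> W) (x : V) :
  C1_at f x -> \forall z \near x, C1_at f z.
Proof. exact: near_join. Qed.

Lemma C1_at_continuous V W (f : V -> W) (x : V) :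
  C1_at f x -> {for x, continuous f}.
Proof. by move=> /nbhs_singleton[]. Qed.

Lemma C1_at_derive V W (f : V -> W) (x v : V) :
  C1_at f x -> is_derive x v f ('D_v f x).
Proof. by move=> /nbhs_singleton[_ /(_ v)[dfx _]]; exact: DeriveDef. Qed.

Lemma C1_at_derive_continuous V W (f : V -> W) (x v : V) :
  C1_at f x -> {for x, continuous (fun y => 'D_v f y)}.
Proof. by move=> /nbhs_singleton[_ /(_ v)[]]. Qed.

Section Scalar.
Context {V : normedModType R}.
Implicit Types f g : V -> R.

Lemma C1_at_cst (a : R) (x : V) : C1_at (fun _ : V => a) x.
Proof.
apply: (@C1_atI _ _ _ (fun _ _ => 0)); apply: nearW => z.
split; first exact: cst_continuous.
move=> v; split; last exact: cst_continuous.
exact: is_derive_cst.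
Qed.

Lemma continuousD_fun f g x : {for x, continuous f} -> {for x, continuous g} ->
  {for x, continuous (fun y => f y + g y)}.
Proof. by move=> cf cg; exact (continuousD cf cg). Qed.

Lemma continuousM_fun f g x : {for x, continuous f} -> {for x, continuous g} ->
  {for x, continuous (fun y => f y * g y)}.
Proof. by move=> cf cg; exact (continuousM cf cg). Qed.

Lemma continuousN_fun f x : {for x, continuous f} ->
  {for x, continuous (fun y => - f y)}.
Proof. by move=> cf; exact (continuousN cf). Qed.

Lemma continuousV_fun f x : f x != 0 -> {for x, continuous f} ->
  {for x, continuous (fun y => (f y)^-1)}.
Proof. by move=> fx cf; exact (continuousV fx cf). Qed.

Lemma is_deriveD_fun f g x v df dg : is_derive x v f df -> is_derive x v g dg ->
  is_derive x v (fun y => f y + g y) (df + dg).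
Proof. by move=> hf hg; exact (is_deriveD hf hg). Qed.

Lemma is_deriveM_fun f g x v df dg : is_derive x v f df -> is_derive x v g dg ->
  is_derive x v (fun y => f y * g y) (f x * dg + g x * df).
Proof. by move=> hf hg; exact (is_deriveM hf hg). Qed.

Lemma C1_atD f g x : C1_at f x -> C1_at g x -> C1_at (fun y => f y + g y) x.
Proof.
move=> /C1_at_near cf /C1_at_near cg.
apply: (@C1_atI _ _ _ (fun v y => 'D_v f y + 'D_v g y)).
apply: filterS2 cf cg => z cf cg.
have cfz := C1_at_continuous cf; have cgz := C1_at_continuous cg.
split; first exact (continuousD_fun cfz cgz).
move=> v; have df := C1_at_derive v cf; have dg := C1_at_derive v cg.
have cdf := C1_at_derive_continuous (v := v) cf.
have cdg := C1_at_derive_continuous (v := v) cg.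
by split; [exact (is_deriveD_fun df dg) | exact (continuousD_fun cdf cdg)].
Qed.

Lemma C1_atM f g x : C1_at f x -> C1_at g x -> C1_at (fun y => f y * g y) x.
Proof.
move=> /C1_at_near cf /C1_at_near cg.
apply: (@C1_atI _ _ _ (fun v y => f y * 'D_v g y + g y * 'D_v f y)).
apply: filterS2 cf cg => z cf cg.
have cfz := C1_at_continuous cf; have cgz := C1_at_continuous cg.
split; first exact (continuousM_fun cfz cgz).
move=> v; have df := C1_at_derive v cf; have dg := C1_at_derive v cg.
have cdf := C1_at_derive_continuous (v := v) cf.
have cdg := C1_at_derive_continuous (v := v) cg.
split; first exact (is_deriveM_fun df dg).
exact (continuousD_fun (continuousM_fun cfz cdg) (continuousM_fun cgz cdf)).
Qed.

Lemma near_pos f x : {for x, continuous f} -> 0 < f x -> \forall y \near x, 0 < f y.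
Proof. by move=> cf fx; exact (cvgr_gt _ cf _ fx). Qed.

Lemma C1_at_inv f x : 0 < f x -> C1_at f x -> C1_at (fun y => (f y)^-1) x.
Proof.
move=> fx cf; have fpos := near_pos (C1_at_continuous cf) fx.
move: cf => /C1_at_near cf.
apply: (@C1_atI _ _ _ (fun v y => - (f y) ^- 2 * 'D_v f y)).
apply: filterS2 fpos cf => z fz cf.
have fz0 : f z != 0 by rewrite gt_eqF.
have ci := continuousV_fun fz0 (C1_at_continuous cf).
split; first exact ci.
move=> v; have df := C1_at_derive v cf.
have cdf := C1_at_derive_continuous (v := v) cf.
split; first exact (is_derive_inv fz0 df).
have c2 : {for z, continuous (fun y => - (f y) ^- 2)}.
  rewrite (_ : (fun y => _) = (fun y => - ((f y)^-1 * (f y)^-1))).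
    exact (continuousN_fun (continuousM_fun ci ci)).
  by apply/funext => y; rewrite expr2 invfM.
exact (continuousM_fun c2 cdf).
Qed.

Lemma C1_at_sqrt f x : 0 < f x -> C1_at f x -> C1_at (fun y => Num.sqrt (f y)) x.
Proof.
move=> fx cf; have fpos := near_pos (C1_at_continuous cf) fx.
move: cf => /C1_at_near cf.
apply: (@C1_atI _ _ _ (fun v y => (2 * Num.sqrt (f y))^-1 * 'D_v f y)).
apply: filterS2 fpos cf => z fz cf.
have cs : {for z, continuous (fun y => Num.sqrt (f y))}.
  by apply: (@continuous_comp _ _ _ f Num.sqrt);
    [exact: C1_at_continuous | exact: sqrt_continuous].
split; first exact cs.
move=> v; have df := C1_at_derive v cf.
have cdf := C1_at_derive_continuous (v := v) cf.
split; first exact (is_derive_sqrt fz df).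
have s0 : 2 * Num.sqrt (f z) != 0 by rewrite mulf_neq0// sqrtr_eq0 -ltNge.
have c2 : {for z, continuous (fun y => 2 * Num.sqrt (f y))}.
  have c0 : {for z, continuous (fun _ : V => 2 : R)} by exact: cst_continuous.
  exact (continuousM_fun c0 cs).
exact (continuousM_fun (continuousV_fun s0 c2) cdf).
Qed.

Lemma C2_at_cst (a : R) (x : V) : C2_at (fun _ : V => a) x.
Proof.
apply: (@C2_atI _ _ _ (fun _ _ => 0)); first exact: C1_at_cst.
  by move=> v; apply: nearW => z; rewrite derive_cst.
by move=> v; exact: C1_at_cst.
Qed.

Lemma C2_atD f g x : C2_at f x -> C2_at g x -> C2_at (fun y => f y + g y) x.
Proof.
move=> [cf df] [cg dg].
apply: (@C2_atI _ _ _ (fun v y => 'D_v f y + 'D_v g y)); first exact (C1_atD cf cg).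
  move=> v; apply: filterS2 (C1_at_near cf) (C1_at_near cg) => z cfz cgz.
  exact (derive_val (is_derive := is_deriveD_fun (C1_at_derive v cfz) (C1_at_derive v cgz))).
by move=> v; exact (C1_atD (df v) (dg v)).
Qed.

Lemma C2_atM f g x : C2_at f x -> C2_at g x -> C2_at (fun y => f y * g y) x.
Proof.
move=> [cf df] [cg dg].
apply: (@C2_atI _ _ _ (fun v y => f y * 'D_v g y + g y * 'D_v f y)).
- exact (C1_atM cf cg).
- move=> v; apply: filterS2 (C1_at_near cf) (C1_at_near cg) => z cfz cgz.
  exact (derive_val (is_derive := is_deriveM_fun (C1_at_derive v cfz) (C1_at_derive v cgz))).
- by move=> v; exact (C1_atD (C1_atM cf (dg v)) (C1_atM cg (df v))).
Qed.

Lemma C2_at_sqrt f x : 0 < f x -> C2_at f x -> C2_at (fun y => Num.sqrt (f y)) x.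
Proof.
move=> fx [cf df]; have fpos := near_pos (C1_at_continuous cf) fx.
apply: (@C2_atI _ _ _ (fun v y => (2 * Num.sqrt (f y))^-1 * 'D_v f y)).
- exact (C1_at_sqrt fx cf).
- move=> v; apply: filterS2 fpos (C1_at_near cf) => z fz cfz.
  exact (derive_val (is_derive := is_derive_sqrt fz (C1_at_derive v cfz))).
- have sx : 0 < 2 * Num.sqrt (f x) by rewrite mulr_gt0// sqrtr_gt0.
  have cs := C1_atM (C1_at_cst 2 x) (C1_at_sqrt fx cf).
  by move=> v; exact (C1_atM (C1_at_inv sx cs) (df v)).
Qed.

Lemma C2_at_sum n (f : 'I_n -> V -> R) x : (forall i, C2_at (f i) x) ->
  C2_at (fun y => \sum_(i < n) f i y) x.
Proof.
move=> cf; suff H (s : seq 'I_n) : C2_at (fun y => \sum_(i <- s) f i y) x by exact: H.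
elim: s => [|i s IHs].
  rewrite (_ : (fun y => _) = fun=> 0); first exact: C2_at_cst.
  by apply/funext => y; rewrite big_nil.
rewrite (_ : (fun y => _) = fun y => f i y + \sum_(j <- s) f j y).
  exact (C2_atD (cf i) IHs).
by apply/funext => y; rewrite big_cons.
Qed.

End Scalar.

Lemma is_derive_lin V W X (L : W -> X) (f : V -> W) (x v : V) df :
  linear L -> continuous L -> is_derive x v f df -> is_derive x v (fun y => L (f y)) (L df).
Proof.
move=> linL cL [dfx <-].
pose LM := GRing.isLinear.Build _ _ _ _ _ linL.
pose LL : {linear _ -> _} := HB.pack L LM.
have lim : (fun h => h^-1 *: (((fun y => L (f y)) \o shift x) (h *: v) - L (f x))) @ 0^'
    --> L ('D_v f x).
  rewrite (_ : (fun h => _) = L \o (fun h => h^-1 *: ((f \o shift x) (h *: v) - f x))).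
    by apply: continuous_cvg dfx; exact: cL.
  by apply/funext => h /=; rewrite -(linearB LL) -(linearZ_LR LL).
apply: DeriveDef; first by apply/cvg_ex; exists (L ('D_v f x)).
exact: cvg_lim lim.
Qed.

Lemma C1_at_lin V W X (L : W -> X) (f : V -> W) (x : V) :
  linear L -> continuous L -> C1_at f x -> C1_at (fun y => L (f y)) x.
Proof.
move=> linL cL /C1_at_near cf; apply: (@C1_atI _ _ _ (fun v y => L ('D_v f y))).
apply: filterS cf => z cf; split.
  by apply: (@continuous_comp _ _ _ f L); [exact: C1_at_continuous | exact: cL].
move=> v; split; first by apply: is_derive_lin => //; exact: C1_at_derive.
by apply: (@continuous_comp _ _ _ (fun y => 'D_v f y) L);
  [exact: C1_at_derive_continuous | exact: cL].
Qed.

Lemma C2_at_lin V W X (L : W -> X) (f : V -> W) (x : V) :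
  linear L -> continuous L -> C2_at f x -> C2_at (fun y => L (f y)) x.
Proof.
move=> linL cL [cf df]; apply: (@C2_atI _ _ _ (fun v y => L ('D_v f y))).
- exact: C1_at_lin.
- move=> v; apply: filterS (C1_at_near cf) => z cfz.
  by apply: derive_val; apply: is_derive_lin => //; exact: C1_at_derive.
- by move=> v; apply: C1_at_lin.
Qed.

End ContinuousDifferentiability.

(** * C^1 functions are differentiable *)

Section Differentiability.
Context {R : realType}.
Implicit Types V W : normedModType R.

Lemma is_deriveZdir V (f : V -> R) (z v : V) (a : R) (d : R) :
  is_derive z v f d -> is_derive z (a *: v) f (a * d).
Proof.
move=> [fz fd].
have L : is_derive (0 : R^o) 1 (fun s : R^o => f (z + s *: v)) d.
  by have := @is_derive_line R V R f z v 0; rewrite scale0r addr0 fd => /(_ fz).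
have La : is_derive (0 : R) 1 (fun s : R => a * s) a.
  have := is_derive_id (0 : R) (1 : R); move=> /(is_deriveZ a).
  by rewrite [a *: 1]mulr1.
have La' : is_derive (a * 0) 1 (fun s : R => f (z + s *: v)) d by rewrite mulr0; exact L.
have [C1 C2] := is_derive_comp1 La La'.
have E : (fun s : R => f (z + s *: v)) \o (fun s : R => a * s) =
    (fun s : R => f (s *: (a *: v) + z)).
  by apply/funext => s /=; rewrite scalerA mulrC addrC.
rewrite E in C1 C2.
have dz : derivable f z (a *: v) by apply/derivable1P; exact C1.
apply: DeriveDef; first exact dz.
have := @is_derive_line R V R f z (a *: v) 0; rewrite scale0r addr0 => /(_ dz)[_ <-].
rewrite mulrC -C2.
by rewrite (_ : (fun s : R^o => _) = (fun s : R => f (s *: (a *: v) + z)))//;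
  apply/funext => s; rewrite addrC.
Qed.

Lemma mean_value V (f : V -> R) (y v : V) :
  (forall t : R, 0 <= t <= 1 -> derivable f (y + t *: v) v) ->
  exists2 t : R, 0 <= t <= 1 & f (y + v) - f y = 'D_v f (y + t *: v).
Proof.
move=> H; have dl (t : R) : 0 <= t <= 1 ->
    is_derive t 1 (fun s : R => f (y + s *: v)) ('D_v f (y + t *: v)).
  by move=> /H dt; exact (is_derive_line dt).
have [t t01 E] : exists2 c : R, c \in `]0, 1[%R &
    f (y + 1 *: v) - f (y + 0 *: v) = 'D_v f (y + c *: v) * (1 - 0).
  apply: (@MVT _ (fun s : R => f (y + s *: v)) (fun s => 'D_v f (y + s *: v))) => //.
    by move=> s /[!in_itv]/= /andP[s0 s1]; apply: dl; rewrite !ltW.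
  apply: derivable_within_continuous => s /[!in_itv]/= /dl[ds _]; exact ds.
exists t; first by move: t01; rewrite in_itv/= => /andP[/ltW-> /ltW->].
by move: E; rewrite scale1r scale0r addr0 subr0 mulr1.
Qed.

Lemma ler_mx_norm_rV n (u : 'rV[R]_n) (e : R) : 0 <= e ->
  (forall i, `|u ord0 i| <= e) -> `|u| <= e.
Proof.
move=> e0 H; rewrite /Num.Def.normr/= mx_normrE bigmax_le// => -[i j] _ /=.
by rewrite ord1.
Qed.

Lemma ler_norm_entry n (u : 'rV[R]_n) i : `|u ord0 i| <= `|u|.
Proof.
by rewrite [leRHS]/Num.Def.normr/= mx_normrE; exact: (le_bigmax _ _ (ord0, i)).
Qed.

Lemma differentiable_linear_approx V W (f : V -> W) (L : {linear V -> W}) (x : V) :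
  continuous L -> (forall e : R, 0 < e ->
    \forall h \near 0, `|f (h + x) - (f x + L h)| <= e * `|h|) ->
  differentiable f x.
Proof.
move=> cL HL; have E : f \o shift x = cst (f x) + L +o_ 0 id.
  apply/eqaddoP => e e0; exact: HL.
apply/diff_locallyP; rewrite (diff_unique cL E); split; first exact cL.
exact E.
Qed.

(** The point [x + h] is reached from [x] by changing one coordinate at a time. By the mean value
    theorem each change costs [h_k] times a partial derivative at a nearby point, which differs from
    its value at [x] by at most [e']. *)
Lemma C1_differentiable n (f : 'rV[R]_n -> R) (x : 'rV[R]_n) :
  C1_at f x -> differentiable f x.
Proof.
move=> cf; pose D i := 'D_(delta_mx ord0 i) f x.
pose L := fun h : 'rV[R]_n => \sum_(i < n) h ord0 i * D i.
have linL : linear L.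
  move=> a u v; rewrite /L scaler_sumr -big_split/=; apply: eq_bigr => i _.
  by rewrite !mxE mulrDl -mulrA.
pose LM := GRing.isLinear.Build _ _ _ _ _ linL.
pose LL : {linear _ -> _} := HB.pack L LM.
have contL : continuous LL.
  apply/linear_bounded_continuous; apply/linear_boundedP.
  near=> r => h /=; rewrite /L.
  apply: le_trans (ler_norm_sum _ _ _) _.
  apply: (@le_trans _ _ (\sum_(i < n) `|h| * `|D i|)).
    by apply: ler_sum => i _; rewrite normrM ler_wpM2r// ler_norm_entry.
  rewrite -mulr_sumr mulrC ler_wpM2r//.
apply: (@differentiable_linear_approx _ _ f LL) => // _/posnumP[e].
(* There are [n] coordinate steps, each with error at most [e'] times the norm of [h]; the
   denominator [n + 1] also covers [n = 0]. *)
pose e' := e%:num / (n%:R + 1).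
have e'0 : 0 < e' by rewrite divr_gt0.
have near_ok : \forall y \near x, (forall v, derivable f y v) /\
    forall i : 'I_n, `|D i - 'D_(delta_mx ord0 i) f y| <= e'.
  have h1 : \forall y \near x, forall v, derivable f y v.
    by apply: filterS cf => y [_ H] v; have [] := H v.
  have h2 : \forall y \near x, forall i : 'I_n, `|D i - 'D_(delta_mx ord0 i) f y| <= e'.
    refine (@filter_forall _ _
      (fun i y => `|D i - derive f y (delta_mx ord0 i)| <= e') (nbhs x) _ _) => i.
    have ci := C1_at_derive_continuous (v := delta_mx ord0 i) cf.
    exact (proj1 (cvgrPdist_le _ _) ci _ e'0).
  by apply: filterS2 h1 h2.
have /nbhs_normP[d d0 Hd] := near_ok.
have near0_lt : \forall h \near (0 : 'rV[R]_n), `|h| < d.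
  apply/nbhs_normP; exists d => // h; rewrite /= sub0r normrN//.
apply: filterS near0_lt => h hd.
(* [hk k] keeps the first [k] coordinates of [h], so it runs from 0 to [h]. *)
pose hk (k : nat) : 'rV[R]_n := \row_i (if (i < k)%N then h ord0 i else 0).
have step (k : 'I_n) : `|f (x + hk k.+1) - f (x + hk k) - h ord0 k * D k| <= `|h| * e'.
  have hkS : hk k.+1 = hk k + h ord0 k *: delta_mx ord0 k.
    apply/rowP => i; rewrite !mxE eqxx/=.
    have [->|ik] := eqVneq i k; first by rewrite ltnSn ltnn add0r mulr1.
    by rewrite mulr0 addr0 ltnS leq_eqVlt (inj_eq val_inj) (negbTE ik).
  (* For the sup norm, every point of the broken line is as close to [x] as [x + h] is, since each
     coordinate of its displacement is bounded by that of [h]. *)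
  have inball (t : R) : 0 <= t <= 1 -> `|x - (x + hk k + t *: (h ord0 k *: delta_mx ord0 k))| < d.
    move=> /andP[t0 t1]; apply: le_lt_trans hd.
    rewrite -addrA opprD addrA subrr add0r normrN.
    apply: ler_mx_norm_rV => // i; rewrite !mxE eqxx/=.
    have [->|ik] := eqVneq i k.
      rewrite ltnn add0r mulr1 normrM ger0_norm//.
      by rewrite -[leRHS]mul1r ler_pM// ler_norm_entry.
    rewrite !mulr0 addr0; case: ifP => _; first exact: ler_norm_entry.
    by rewrite normr0.
  have [|t t01] := @mean_value _ f (x + hk k) (h ord0 k *: delta_mx ord0 k).
    by move=> t /inball /Hd[].
  have [dt Dt] := Hd _ (inball _ t01).
  rewrite -addrA -hkS => ->.
  have [_ ->] := is_deriveZdir (h ord0 k) (derivableP (dt (delta_mx ord0 k))).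
  rewrite -mulrBr normrM; apply: ler_pM => //; first exact: ler_norm_entry.
  by rewrite distrC.
have tele : f (h + x) - f x = \sum_(k < n) (f (x + hk k.+1) - f (x + hk k)).
  rewrite -(big_mkord xpredT (fun k => f (x + hk k.+1) - f (x + hk k))).
  rewrite (telescope_sumr (fun k => f (x + hk k)))//; congr (f _ - f _).
    by rewrite addrC; congr (_ + _); apply/rowP => i; rewrite mxE ltn_ord.
  by rewrite (_ : hk 0%N = 0) ?addr0//; apply/rowP => i; rewrite !mxE.
rewrite opprD addrA tele /L -sumrB.
apply: le_trans (ler_norm_sum _ _ _) _.
apply: (@le_trans _ _ (\sum_(k < n) `|h| * e')).
  by apply: ler_sum => k _; exact: step.
rewrite sumr_const card_ord -mulr_natr [leRHS]mulrC -mulrA ler_wpM2l//.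
by rewrite /e' mulrAC ler_pdivrMr// ler_wpM2l// lerDl.
Unshelve. all: by end_near. Qed.

Definition gradient n (f : 'rV[R]_n -> R) (x : 'rV[R]_n) : 'rV[R]_n :=
  \row_i 'D_(delta_mx ord0 i) f x.

Lemma derive_gradient n (f : 'rV[R]_n -> R) (x v : 'rV[R]_n) : C1_at f x ->
  'D_v f x = dot (gradient f x) v.
Proof.
move=> /C1_differentiable df; rewrite deriveE// {1}(row_sum_delta v) linear_sum.
apply: eq_bigr => i _; rewrite linearZ/= mxE deriveE//; exact: mulrC.
Qed.

End Differentiability.

(** * Euclidean norm, local minima, boundary crossing *)

Section Dot.
Context {R : realType} {n : nat}.
Implicit Types u v w : 'rV[R]_n.

Lemma dotC u v : dot u v = dot v u.
Proof. by apply: eq_bigr => i _; rewrite mulrC. Qed.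

Lemma dotDl u v w : dot (u + v) w = dot u w + dot v w.
Proof. by rewrite -big_split; apply: eq_bigr => i _; rewrite mxE mulrDl. Qed.

Lemma dotZl a u v : dot (a *: u) v = a * dot u v.
Proof. by rewrite mulr_sumr; apply: eq_bigr => i _; rewrite mxE mulrA. Qed.

Lemma dotNl u v : dot (- u) v = - dot u v.
Proof. by rewrite -scaleN1r dotZl mulN1r. Qed.

Lemma dotDr u v w : dot w (u + v) = dot w u + dot w v.
Proof. by rewrite dotC dotDl !(dotC w). Qed.

Lemma dotZr a u v : dot u (a *: v) = a * dot u v.
Proof. by rewrite dotC dotZl dotC. Qed.

Lemma dotNr u v : dot u (- v) = - dot u v.
Proof. by rewrite dotC dotNl dotC. Qed.

Definition dotE := (dotDl, dotDr, dotNl, dotNr, dotZl, dotZr).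

Lemma dot0l u : dot 0 u = 0.
Proof. by rewrite -(scale0r 0) dotZl mul0r. Qed.

Lemma dot_ge0 u : 0 <= dot u u.
Proof. by apply: sumr_ge0 => i _; rewrite -expr2 sqr_ge0. Qed.

Lemma dot_eq0 u : (dot u u == 0) = (u == 0).
Proof.
apply/eqP/eqP => [|->]; last by rewrite dot0l.
move=> /eqP; rewrite psumr_eq0 => [|i _]; last by rewrite -expr2 sqr_ge0.
move=> /allP H; apply/rowP => i; rewrite mxE.
by have /(_ (mem_index_enum i)) := H i; rewrite -expr2 sqrf_eq0 => /eqP.
Qed.

Lemma dot_gt0 u : (0 < dot u u) = (u != 0).
Proof. by rewrite lt_def dot_ge0 dot_eq0 andbT. Qed.

Lemma enorm_ge0 u : 0 <= enorm u.
Proof. exact: sqrtr_ge0. Qed.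

Lemma enorm_sqr u : enorm u ^+ 2 = dot u u.
Proof. by rewrite sqr_sqrtr// dot_ge0. Qed.

Lemma enorm_gt0 u : (0 < enorm u) = (u != 0).
Proof. by rewrite sqrtr_gt0 dot_gt0. Qed.

Lemma enormN u : enorm (- u) = enorm u.
Proof. by rewrite /enorm dotNl dotNr opprK. Qed.

Lemma enormB u v : enorm (u - v) = enorm (v - u).
Proof. by rewrite -enormN opprB. Qed.

Lemma enormZ a u : enorm (a *: u) = `|a| * enorm u.
Proof.
by rewrite /enorm dotZl dotZr mulrA -expr2 sqrtrM ?sqr_ge0// sqrtr_sqr.
Qed.

(* The component of [u] orthogonal to [q] is orthogonal to itself. *)
Lemma orthogonal_to_hyperplane u q : q != 0 ->
  (forall v, dot q v = 0 -> dot u v = 0) -> u = (dot u q / dot q q) *: q.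
Proof.
move=> q0 H; set k := _ / _; apply/eqP; rewrite -subr_eq0; apply/eqP.
have qq : dot q q != 0 by rewrite dot_eq0.
have qv : dot q (u - k *: q) = 0.
  by rewrite !dotE /k divfK// dotC subrr.
apply/eqP; rewrite -dot_eq0; apply/eqP.
by rewrite dotDl dotNl dotZl qv (H _ qv) mulr0 subr0.
Qed.

End Dot.

Section OneVariable.
Context {R : realType}.

Lemma near0_ball (P : set R) : (\forall t \near (0 : R), P t) ->
  exists2 e : R, 0 < e & forall t, `|t| < e -> P t.
Proof.
move=> /nbhs_ballP[e /= e0 He]; exists e => // t te.
by apply: He; rewrite /ball/= sub0r normrN.
Qed.

Lemma near0_pos (P : set R) : (\forall t \near (0 : R), P t) ->
  exists2 t : R, 0 < t & P t.
Proof.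
move=> /near0_ball[e e0 He]; exists (e / 2); first by rewrite divr_gt0.
by apply: He; rewrite gtr0_norm ?divr_gt0// ltr_pdivrMr// ltr_pMr// ltr1n.
Qed.

Lemma near0_neg (P : set R) : (\forall t \near (0 : R), P t) ->
  exists2 t : R, t < 0 & P t.
Proof.
move=> /near0_ball[e e0 He]; exists (- (e / 2)); first by rewrite oppr_lt0 divr_gt0.
by apply: He; rewrite normrN gtr0_norm ?divr_gt0// ltr_pdivrMr// ltr_pMr// ltr1n.
Qed.

Lemma near0_lt1 : \forall t \near (0 : R), `|t| < 1.
Proof. exact: nbhs0_lt. Qed.

(** The difference quotient at 0 is positive near 0 because its limit is. *)
Lemma is_derive_pos_sign (h : R -> R) (d : R) :
  is_derive (0 : R^o) 1 (h : R^o -> R) d -> 0 < d ->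
  \forall t \near (0 : R), (0 < t -> h 0 < h t) /\ (t < 0 -> h t < h 0).
Proof.
move=> [cv dE] d0.
have lim : (fun t : R => t^-1 * (h t - h 0)) @ 0^' --> d.
  rewrite -dE; rewrite /derivable /derive in cv *.
  rewrite (_ : (fun t : R => t^-1 * (h t - h 0)) =
     (fun t : R => t^-1 *: ((h \o shift 0) (t *: 1) - h 0))); first exact cv.
  by apply/funext => t /=; rewrite addr0 [_ *: 1]mulr1.
have := cvgr_gt d lim _ d0; rewrite near_withinE => /(_ _) Hlim.
apply: filterS Hlim => t Ht.
split=> t0.
  have := Ht (lt0r_neq0 t0).
  by rewrite pmulr_rgt0 ?invr_gt0// subr_gt0.
have := Ht (ltr0_neq0 t0).
by rewrite nmulr_rgt0 ?invr_lt0// subr_lt0.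
Qed.

Lemma is_derive_local_min (h : R -> R) (d : R) :
  is_derive (0 : R^o) 1 (h : R^o -> R) d ->
  (\forall t \near (0 : R), h 0 <= h t) -> d = 0.
Proof.
move=> dh hmin; apply/eqP; rewrite eq_le !leNgt; apply/andP; split; apply/negP => d0.
  have [t t0 [hle [_ /(_ t0)]]] := near0_neg (filterI hmin (is_derive_pos_sign dh d0)).
  by rewrite ltNge hle.
have dh' : is_derive (0 : R^o) 1 ((fun t => - h t) : R^o -> R) (- d).
  exact (is_deriveN dh).
have nd0 : 0 < - d by rewrite oppr_gt0.
have [t t0 [hle [/(_ t0) + _]]] := near0_pos (filterI hmin (is_derive_pos_sign dh' nd0)).
by rewrite ltrN2 ltNge hle.
Qed.

(** The first derivative vanishes at 0. If [h2] were negative, it would be negative just to the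
    right of 0, and by the mean value theorem [h] would fall below [h 0] there. *)
Lemma second_derive_local_min (h h1 : R -> R) (h2 : R) :
  (\forall t \near (0 : R), is_derive (t : R^o) 1 (h : R^o -> R) (h1 t)) ->
  is_derive (0 : R^o) 1 (h1 : R^o -> R) h2 ->
  (\forall t \near (0 : R), h 0 <= h t) -> 0 <= h2.
Proof.
move=> dh dh1 hmin; rewrite leNgt; apply/negP => h20.
have h10 : h1 0 = 0 by apply: is_derive_local_min hmin; exact: (nbhs_singleton dh).
have dh1' : is_derive (0 : R^o) 1 ((fun t => - h1 t) : R^o -> R) (- h2).
  exact (is_deriveN dh1).
have nh2 : 0 < - h2 by rewrite oppr_gt0.
have hs := is_derive_pos_sign dh1' nh2.
have [e e0 He] := near0_ball (filterI dh (filterI hmin hs)).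
pose t := e / 2; have t0 : 0 < t by rewrite divr_gt0.
have te s : 0 <= s <= t -> `|s| < e.
  move=> /andP[s0 st]; rewrite ger0_norm//.
  by apply: le_lt_trans st _; rewrite ltr_pdivrMr// ltr_pMr// ltr1n.
have dhs s : 0 <= s <= t -> is_derive (s : R) (1 : R) h (h1 s).
  by move=> /te /He[hs' _]; exact hs'.
have [c] : exists2 c, c \in `]0, t[%R & h t - h 0 = h1 c * (t - 0).
  apply: MVT => // [s /[!in_itv]/= /andP[s0 st]|]; first by apply: dhs; rewrite !ltW.
  by apply: derivable_within_continuous => s /[!in_itv]/= /dhs[].
rewrite in_itv/= => /andP[c0 ct].
have [|_ [_ [/(_ c0) + _]]] := He c; first by apply: te; rewrite !ltW.
rewrite h10 oppr0 oppr_gt0 => hc E.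
have [|_ [+ _]] := He t; first by apply: te; rewrite lexx ltW.
have : h t - h 0 < 0 by rewrite E addr0 nmulr_rlt0.
by rewrite subr_lt0 => /lt_geF ->.
Qed.

End OneVariable.

Section Norm.
Context {R : realType}.

Lemma is_derive_enorm (V : normedModType R) n (F : V -> 'rV[R]_n) (x v : V) dF :
  F x != 0 -> is_derive x v F dF ->
  is_derive x v (fun y => enorm (F y)) (dot (F x) dF / enorm (F x)).
Proof.
move=> F0 dFx; have Fpos : 0 < dot (F x) (F x) by rewrite dot_gt0.
have H := is_derive_sqrt (f := fun y => dot (F y) (F y)) Fpos (is_derive_dot dFx dFx).
have e0 : enorm (F x) != 0 by rewrite gt_eqF// enorm_gt0.
rewrite (_ : _ / _ = (2 * enorm (F x))^-1 * (dot dF (F x) + dot (F x) dF)); first exact H.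
by rewrite (dotC dF); field.
Qed.

(** The function differentiated here is the derivative of the norm along [c] found in
    [is_derive_enorm]; the value is therefore the second derivative of the norm along a curve with
    velocity [c1 0] and acceleration [c2]. *)
Lemma second_derive_enorm n (c c1 : R^o -> 'rV[R]_n) c2 :
  c 0 != 0 -> is_derive (0 : R^o) 1 c (c1 0) -> is_derive (0 : R^o) 1 c1 c2 ->
  is_derive (0 : R^o) 1 (fun t => dot (c t) (c1 t) / enorm (c t))
    ((dot (c1 0) (c1 0) + dot (c 0) c2) / enorm (c 0)
     - dot (c 0) (c1 0) ^+ 2 / enorm (c 0) ^+ 3).
Proof.
move=> c0 dc dc1; have e0 : enorm (c 0) != 0 by rewrite gt_eqF// enorm_gt0.
have H := is_deriveM_fun (is_derive_dot dc dc1)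
  (is_derive_inv (f := fun t => enorm (c t)) e0 (is_derive_enorm c0 dc)).
rewrite (_ : _ - _ = dot (c 0) (c1 0) * (- enorm (c 0) ^- 2 * (dot (c 0) (c1 0) / enorm (c 0)))
   + (enorm (c 0))^-1 * (dot (c1 0) (c1 0) + dot (c 0) c2)); first exact H.
by field.
Qed.

Lemma C2_at_enorm (V : normedModType R) n (F : V -> 'rV[R]_n) (x : V) :
  F x != 0 -> (forall i, C2_at (fun y => F y ord0 i) x) ->
  C2_at (fun y => enorm (F y)) x.
Proof.
move=> F0 cF; apply: C2_at_sqrt; first by rewrite dot_gt0.
by apply: C2_at_sum => i; exact (C2_atM (cF i) (cF i)).
Qed.

End Norm.

(** If the segment avoided the boundary, the parameters sent to the interior and those sent to the
    closure would coincide. They would form a nonempty open and closed part of the connected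
    interval [0, 1], hence contain 1. *)
Lemma segment_meets_boundary (R : realType) (V : normedModType R) (A : set V)
    (a b : V) : interior A a -> ~ interior A b ->
  exists2 t : R, 0 <= t <= 1 & boundary A (a + t *: (b - a)).
Proof.
move=> Aa Ab; apply: contrapT => H.
pose g (t : R) := a + t *: (b - a).
have cg : continuous g.
  move=> t; apply: cvgD; first exact: cvg_cst.
  by apply: cvgZl; exact: cvg_id.
have E : `[0, 1] `&` g @^-1` (interior A) = `[0, 1] `&` g @^-1` (closure A) :> set R.
  apply/seteqP; split=> t [t01 gt]; split=> //.
    by apply: subset_closure; exact: interior_subset gt.
  apply: contrapT => ngt; apply: H; exists t; last by split.
  by have := t01; rewrite /= in_itv.
have conn : connected (`[0, 1]%classic : set R).
  exact/connected_intervalP/interval_is_interval.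
have C : `[0, 1]%classic `&` g @^-1` (interior A) = `[0, 1]%classic :> set R.
  apply: conn.
  - by exists 0; split; rewrite /= ?in_itv/= ?lexx ?ler01// /g scale0r addr0.
  - exists (g @^-1` (interior A)) => //; apply: open_comp => //; exact: open_interior.
  - exists (g @^-1` (closure A)) => //; apply: closed_comp => //; exact: closed_closure.
have : (`[0, 1]%classic : set R) 1 by rewrite /= in_itv/= lexx ler01.
by rewrite -C => -[_]; rewrite /g/= scale1r addrC subrK.
Qed.

(** * Gradient and tangent space of a C^2 boundary *)

Section Surfaces.
Context {R : realType} {n : nat}.
Implicit Types (U : set 'rV[R]_n) (rho : 'rV[R]_n -> R) (x v z : 'rV[R]_n).

(** Stated at an arbitrary point, on the boundary or not, so that it spreads to a neighbourhood
    ([defining_function_near]). *)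
Definition defining_function U rho x :=
  [/\ C1_at rho x, gradient rho x != 0 & \forall y \near x, U y <-> rho y < 0].

Lemma near_neq0 rho x : {for x, continuous rho} -> rho x != 0 ->
  \forall y \near x, rho y != 0.
Proof. by move=> cf fx; exact (cvgr_neq0 _ cf fx). Qed.

Lemma near_gradient_neq0 rho x v : C1_at rho x -> 'D_v rho x != 0 ->
  \forall y \near x, gradient rho y != 0.
Proof.
move=> cr dv; have cd := C1_at_derive_continuous (v := v) cr.
apply: filterS2 (C1_at_near cr) (near_neq0 cd dv) => y cy; apply: contra_neq => g0.
by rewrite derive_gradient// g0 dot0l.
Qed.

Lemma defining_function_near U rho x : defining_function U rho x ->
  \forall y \near x, defining_function U rho y.
Proof.
move=> [cr g0 Ur]; have gd : 'D_(gradient rho x) rho x != 0.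
  by rewrite derive_gradient// dot_eq0.
apply: filterS3 (C1_at_near cr) (near_gradient_neq0 cr gd) (near_join Ur) => y.
by split.
Qed.

Lemma C2_boundary_defining U x : C2_boundary U -> boundary U x ->
  exists2 rho, C2_at rho x & defining_function U rho x.
Proof.
move=> /[apply] -[rho [C2r [v dv] Ur]]; exists rho; first exact C2r.
have C1r : C1_at (rho : _ -> R) x by exact (proj1 C2r).
split=> //; exact (nbhs_singleton (near_gradient_neq0 C1r dv)).
Qed.

Lemma defining_lt0 U rho x : defining_function U rho x -> rho x < 0 -> interior U x.
Proof.
move=> [cr _ Ur] rx.
apply: filterS2 Ur (cvgr_lt _ (C1_at_continuous cr) _ rx) => y Uy ry.
exact/Uy.
Qed.

Lemma defining_gt0 U rho x : defining_function U rho x -> 0 < rho x -> ~ closure U x.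
Proof.
move=> [cr _ Ur] rx clU.
have [y [Uy nUy]] := clU _ (filterI Ur (cvgr_gt _ (C1_at_continuous cr) _ rx)).
by move: nUy => /= [[/(_ Uy)] + _]; rewrite ltNge => /negP + /ltW.
Qed.

Lemma near_line (P : set 'rV[R]_n) x v : (\forall y \near x, P y) ->
  \forall t \near (0 : R), P (x + t *: v).
Proof.
move=> HP; have cl : {for (0 : R), continuous (fun t : R => x + t *: v)}.
  by apply: cvgD; [exact: cvg_cst | apply: cvgZl; exact: cvg_id].
by apply: cl; rewrite scale0r addr0.
Qed.

(** Along such a direction [rho] increases through 0, so the line passes from the interior of [U] to
    the complement of its closure. All later arguments on which side of a surface a point lies rest
    on this. *)
Lemma defining_line U rho x v : defining_function U rho x -> rho x = 0 ->
  0 < dot (gradient rho x) v ->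
  \forall t \near (0 : R), (0 < t -> ~ closure U (x + t *: v)) /\
                           (t < 0 -> interior U (x + t *: v)).
Proof.
move=> dU r0 gv; have [cr _ _] := dU.
have L : is_derive (0 : R^o) 1 (fun t : R^o => rho (x + t *: v)) (dot (gradient rho x) v).
  have := @is_derive_line R _ R rho x v 0; rewrite scale0r addr0 derive_gradient//.
  by apply; have [] := C1_at_derive v cr.
apply: filterS2 (near_line v (defining_function_near dU)) (is_derive_pos_sign L gv).
move=> t dt; rewrite scale0r addr0 r0 => -[tp tn]; split=> [/tp|/tn].
  exact: defining_gt0.
exact: defining_lt0.
Qed.

(** That zeros of [rho] are limits of points of [U] comes from the nonzero gradient: stepping back
    along it enters [U]. *)
Lemma boundary_eq0 U rho x : defining_function U rho x -> boundary U x <-> rho x = 0.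
Proof.
move=> dU; split=> [[clU nintU]|r0].
  have [r0|r0|//] := ltgtP (rho x) 0; first by case: nintU; exact: defining_lt0 r0.
  by have := defining_gt0 dU r0.
have [_ g0 Ur] := dU; split; last first.
  by move=> /interior_subset /(nbhs_singleton Ur); rewrite r0 ltxx.
move=> B xB.
have gg : 0 < dot (gradient rho x) (gradient rho x) by rewrite dot_gt0.
have [t t0 [[_ /(_ t0)/interior_subset Uy] By]] :=
  near0_neg (filterI (defining_line dU r0 gg) (near_line (gradient rho x) xB)).
by eexists; split; [exact: Uy | exact: By].
Qed.

Lemma tangent_gradient U rho v (c : R^o -> 'rV[R]_n) (t : R^o) :
  defining_function U rho (c t) -> is_derive t 1 c v ->
  (\forall s \near t, boundary U (c s)) -> dot (gradient rho (c t)) v = 0.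
Proof.
move=> dU dc bc; have [cr _ _] := dU.
have cc : {for t, continuous c}.
  by apply: differentiable_continuous; apply/derivable1_diffP; have [] := dc.
have E : \forall s \near t, rho (c s) = 0.
  apply: filterS2 bc (cc _ (defining_function_near dU)) => s bs ds.
  exact/(boundary_eq0 ds).
have := is_derive_comp_differentiable dc (C1_differentiable cr).
move=> [_]; rewrite derive_gradient// => <-.
by rewrite (near_eq_derive _ (_ : \near t, (rho \o c) t = cst 0 t))// derive_cst.
Qed.

(** The required curve is [x + t v + s(t) e], where [e] is the gradient and the correction [s(t)]
    brings the point back to the zero set. The intermediate value theorem gives such an [s(t)] of
    size at most [|rho (x + t v)| / m], and [rho (x + t v)] has derivative 0 at 0, so [s] has
    derivative 0 there and the velocity is [v]. *)
Lemma gradient_tangent U rho x v : defining_function U rho x -> rho x = 0 ->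
  dot (gradient rho x) v = 0 -> tangent_space (boundary U) x v.
Proof.
move=> dU r0 gv; have [cr g0 _] := dU.
(* The derivative of [rho] along [e] at [x] is [dot e e]; half of it is a lower bound on a
   neighbourhood. *)
set e := gradient rho x; pose m := dot e e / 2.
have ee0 : 0 < dot e e by rewrite dot_gt0.
have m0 : 0 < m by rewrite divr_gt0.
have near_ok : \forall y \near x, [/\ defining_function U rho y & m < 'D_e rho y].
  have mlt : m < 'D_e rho x by rewrite derive_gradient// ltr_pdivrMr// ltr_pMr// ltr1n.
  have cd := C1_at_derive_continuous (v := e) cr.
  by apply: filterS2 (defining_function_near dU) (cvgr_gt _ cd _ mlt).
have /nbhs_normP[d d0 Hd] := near_ok.
pose a (t : R) := rho (x + t *: v).
have da : is_derive (0 : R^o) 1 (a : R^o -> R) 0.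
  have := @is_derive_line R _ R rho x v 0; rewrite scale0r addr0 derive_gradient// gv.
  by apply; have [] := C1_at_derive v cr.
have ca : {for (0 : R), continuous a}.
  by apply: differentiable_continuous; apply/derivable1_diffP; have [] := da.
have a0 : a 0 = 0 by rewrite /a scale0r addr0.
pose spec t := [set s : R | `|s| <= `|a t| / m /\ rho (x + t *: v + s *: e) = 0].
(* This keeps all candidates [x + t v + s e] with [|s| <= |a t| / m] in the ball where the lower
   bound [m] holds. *)
have small : \forall t \near (0 : R), `|t| * `|v| + `|a t| / m * `|e| < d.
  have c1 : {for (0 : R), continuous (fun t : R => `|t| * `|v| + `|a t| / m * `|e|)}.
    apply: cvgD; apply: cvgM; first exact: norm_continuous.
    - exact: cvg_cst.
    - apply: cvgM; last exact: cvg_cst.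
      exact (cvg_norm ca).
    - exact: cvg_cst.
  apply: (cvgr_lt _ c1); by rewrite normr0 a0 normr0 !mul0r addr0.
have spec_ex : \forall t \near (0 : R), exists s, spec t s.
  apply: filterS small => t td; set sg := `|a t| / m.
  have sg0 : 0 <= sg by rewrite divr_ge0// ltW.
  have inball s : `|s| <= sg -> [/\ defining_function U rho (x + t *: v + s *: e) &
      m < 'D_e rho (x + t *: v + s *: e)].
    move=> ssg; apply: Hd => /=; rewrite -addrA opprD addrA subrr add0r normrN.
    apply: le_lt_trans td; apply: le_trans (ler_normD _ _) _.
    by rewrite !normrZ lerD// ler_wpM2r.
  (* Along [e] the function [rho] grows at rate at least [m], so shifts of [|a t| / m] either way
     reach opposite signs, in the weak sense. *)
  have mv s : `|s| <= sg -> exists2 k, m <= k & rho (x + t *: v + s *: e) - a t = s * k.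
    move=> ssg; have ib u : 0 <= u <= 1 -> `|u * s| <= sg.
      by move=> /andP[u0 u1]; rewrite normrM ger0_norm// -[leRHS]mul1r ler_pM.
    have [u u01|u u01 E] := @mean_value R _ rho (x + t *: v) (s *: e).
      have [[cy _ _] _] := inball _ (ib _ u01).
      by rewrite scalerA; have [] := C1_at_derive (s *: e) cy.
    have [[cy _ _] my] := inball _ (ib _ u01).
    exists ('D_e rho (x + t *: v + (u * s) *: e)); first exact: ltW.
    rewrite /a E scalerA.
    by have [_ ->] := is_deriveZdir s (C1_at_derive e cy).
  have [k1 k1m E1] := mv sg (ltac:(by rewrite ger0_norm)).
  have [k2 k2m E2] := mv (- sg) (ltac:(by rewrite normrN ger0_norm)).
  have sgm : sg * m = `|a t| by rewrite divfK// gt_eqF.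
  have F1 : 0 <= rho (x + t *: v + sg *: e).
    have : `|a t| <= sg * k1 by rewrite -sgm ler_wpM2l.
    have := ler_norm (- a t); rewrite normrN => ? ?; lra.
  have F2 : rho (x + t *: v + (- sg) *: e) <= 0.
    have : `|a t| <= sg * k2 by rewrite -sgm ler_wpM2l.
    have := ler_norm (a t) => ? ?; lra.
  have [s] : exists2 s, s \in `[- sg, sg]%R & rho (x + t *: v + s *: e) = 0.
    apply: (@IVT R (fun s => rho (x + t *: v + s *: e))).
    - by rewrite ge0_cp.
    - apply: derivable_within_continuous => s; rewrite in_itv/= -ler_norml => ssg.
      have [[cy _ _] _] := inball _ ssg.
      have [ds _] := @is_derive_line R _ R rho (x + t *: v) e s (ltac:(by have [] := C1_at_derive e cy)).
      exact ds.
    - by rewrite ge_min F2 le_max F1 orbT.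
  by rewrite in_itv/= -ler_norml => ssg rs; exists s.
pose s t := get (spec t).
have Hs : \forall t \near (0 : R), spec t (s t).
  by apply: filterS spec_ex => t; exact: getPex.
(* At [t = 0] the size bound in [spec] leaves only the root 0. *)
have s0 : s 0 = 0.
  have [+ _] := nbhs_singleton Hs.
  by rewrite a0 normr0 mul0r normr_le0 => /eqP.
have ds : is_derive (0 : R^o) 1 (s : R^o -> R) 0.
  have lim : (fun t : R => t^-1 *: ((s \o shift 0) (t *: 1) - s 0)) @ 0^' --> (0 : R).
    have lima : (fun t : R => t^-1 *: ((a \o shift 0) (t *: 1) - a 0)) @ 0^' --> (0 : R).
      by have [dal dav] := da; rewrite -[X in _ --> X]dav; exact dal.
    have lim2 : (fun t : R => `|t^-1 *: ((a \o shift 0) (t *: 1) - a 0)| / m) @ 0^' --> (`|0 : R| / m).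
      by apply: cvgM; [exact (cvg_norm lima) | exact: cvg_cst].
    rewrite normr0 mul0r in lim2.
    apply/norm_cvg0P; apply: (squeeze_cvgr _ (cvg_cst 0) lim2).
    rewrite near_withinE; apply: filterS Hs => t [st _] _ /=.
    rewrite normr_ge0/= addr0 [t *: 1]mulr1 s0 a0 !subr0 !normrZ -mulrA.
    by rewrite ler_wpM2l.
  by apply: DeriveDef; [apply/cvg_ex; exists 0 | exact: cvg_lim lim].
pose c (t : R^o) := x + t *: v + s t *: e.
have dc : is_derive (0 : R^o) 1 c v.
  apply: is_derive_row => i.
  have dt := is_deriveM_fun (is_derive_id (0 : R) (1 : R)) (is_derive_cst (v ord0 i) (0 : R) (1 : R)).
  have dsi := is_deriveM_fun ds (is_derive_cst (e ord0 i) (0 : R^o) (1 : R^o)).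
  have H := is_deriveD_fun (is_deriveD_fun (is_derive_cst (x ord0 i) (0 : R) (1 : R)) dt) dsi.
  rewrite (_ : (fun t => _) = (fun t : R^o => x ord0 i + t * v ord0 i + s t * e ord0 i)).
    have E : 0 + (0 * 0 + v ord0 i * 1) + (s 0 * 0 + e ord0 i * 0) = v ord0 i by ring.
    rewrite -[X in is_derive _ _ _ X]E; exact H.
  by apply/funext => t; rewrite !mxE.
have c0 : c 0 = x by rewrite /c s0 !scale0r !addr0.
exists c; split=> //.
have cc : {for (0 : R^o), continuous c}.
  by apply: differentiable_continuous; apply/derivable1_diffP; have [] := dc.
have dUc : \forall t \near (0 : R), defining_function U rho (c t).
  by apply: cc; rewrite c0; exact: defining_function_near.
by apply: filterS2 Hs dUc => t [_ rt] /boundary_eq0 ->.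
Qed.

End Surfaces.

(** * Outward normal and Weingarten map *)

Section Normals.
Context {R : realType} {n : nat}.
Implicit Types (U : set 'rV[R]_n) (rho : 'rV[R]_n -> R) (x v z : 'rV[R]_n).

Definition unit_gradient rho x := (enorm (gradient rho x))^-1 *: gradient rho x.

Lemma unit_gradient_normal U rho x : defining_function U rho x -> rho x = 0 ->
  is_outward_normal U x (unit_gradient rho x).
Proof.
move=> dU r0; have [cr g0 _] := dU.
have ge0 : 0 < enorm (gradient rho x) by rewrite enorm_gt0.
split.
- by rewrite enormZ gtr0_norm ?invr_gt0// mulVf// gt_eqF.
- move=> v [c [c0 cb dc]]; have dUc : defining_function U rho (c 0) by rewrite c0.
  by rewrite /unit_gradient dotZl -c0 (tangent_gradient dUc dc cb) mulr0.
- have gp : 0 < dot (gradient rho x) (unit_gradient rho x).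
    by rewrite /unit_gradient dotZr mulr_gt0 ?invr_gt0// dot_gt0.
  rewrite near_withinE; apply: filterS (defining_line dU r0 gp) => t [+ _].
  by [].
Qed.

(** By [gradient_tangent] the tangent vectors fill the hyperplane orthogonal to the gradient, so
    [nu] is a multiple of the gradient; the exterior condition fixes the sign and the unit length
    fixes the factor. *)
Lemma outward_normal_unique U rho x nu : defining_function U rho x -> rho x = 0 ->
  is_outward_normal U x nu -> nu = unit_gradient rho x.
Proof.
move=> dU r0 [nu1 nut nuo]; have [cr g0 _] := dU.
set g := gradient rho x in g0 *; have ge0 : 0 < enorm g by rewrite enorm_gt0.
have gg0 : 0 < dot g g by rewrite dot_gt0.
have E : nu = (dot nu g / dot g g) *: g.
  by apply: orthogonal_to_hyperplane => // v gv; apply: nut; exact: gradient_tangent gv.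
have k0 : 0 <= dot nu g.
  rewrite leNgt; apply/negP => neg.
  (* Backward steps along [- nu], that is forward steps along [nu], would then enter [U]. *)
  have gn : 0 < dot g (- nu) by rewrite dotNr dotC oppr_gt0.
  have H := defining_line dU r0 gn.
  have [e e0 He] : exists2 e : R, 0 < e & forall t, `|t| < e -> 0 < t -> ~ closure U (x + t *: nu).
    by move: nuo; rewrite near_withinE => /near0_ball.
  have [t t0 [te [_ /(_ t0)]]] := near0_neg (filterI (nbhs0_lt e0) H).
  rewrite scalerN -scaleNr => /interior_subset /subset_closure.
  by apply: He; rewrite ?normrN// oppr_gt0.
have ne : `|dot nu g / dot g g| * enorm g = 1 by rewrite -enormZ -E.
rewrite ger0_norm ?divr_ge0 ?(ltW gg0)// in ne.
rewrite E /unit_gradient; congr (_ *: _).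
have gn0 : enorm g != 0 by rewrite gt_eqF.
by apply: (mulIf gn0); rewrite ne mulVf.
Qed.

Lemma outward_normalE U rho x : defining_function U rho x -> boundary U x ->
  outward_normal U x = unit_gradient rho x.
Proof.
move=> dU /(boundary_eq0 dU) r0; apply: (outward_normal_unique dU r0).
apply: getPex; exists (unit_gradient rho x); exact: unit_gradient_normal.
Qed.

Lemma curve_through_continuous (S : set 'rV[R]_n) x v c :
  curve_through S x v c -> c t @[t --> (0 : R^o)] --> x.
Proof.
move=> [<- _ [dc _]].
by apply: differentiable_continuous; apply/derivable1_diffP.
Qed.

(** The map is defined by a choice, which is meaningful once one vector serves all curves with
    velocity [v]. That vector is [w], the derivative of the normalized gradient, which depends on
    [rho], [x] and [v] only. *)
Lemma weingarten_is_derive U rho x v c : C2_at rho x -> defining_function U rho x ->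
  curve_through (boundary U) x v c ->
  is_derive (0 : R^o) 1 (outward_normal U \o c) (weingarten U x v).
Proof.
move=> C2r dU; have [_ g0 _] := dU.
pose dG : 'rV[R]_n := \row_i 'D_v (fun y => 'D_(delta_mx ord0 i) rho y) x.
set G := gradient rho x in g0 *; have e0 : enorm G != 0 by rewrite gt_eqF// enorm_gt0.
(* Product rule for the gradient times the inverse of its norm, [dG] being the derivative of the
   gradient along [v]. *)
pose w := \row_i ((enorm G)^-1 * dG ord0 i + G ord0 i * (- enorm G ^- 2 * (dot G dG / enorm G))).
have Hw c' : curve_through (boundary U) x v c' ->
    is_derive (0 : R^o) 1 (outward_normal U \o c') w.
  move=> cc'; have [c0 cb dc] := cc'.
  have dGc : is_derive (0 : R^o) 1 (gradient rho \o c') dG.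
    apply: is_derive_row => i; rewrite mxE.
    have cd : C1_at (fun y => 'D_(delta_mx ord0 i) rho y) (c' 0) by rewrite c0; exact (proj2 C2r _).
    rewrite (_ : (fun t => _) = (fun y => 'D_(delta_mx ord0 i) rho y) \o c'); last first.
      by apply/funext => t /=; rewrite mxE.
    by have := is_derive_comp_differentiable dc (C1_differentiable cd); rewrite c0.
  have Gc0 : (gradient rho \o c') 0 = G by rewrite /= c0.
  have Gcn0 : (gradient rho \o c') 0 != 0 by rewrite Gc0.
  have ec0 : enorm ((gradient rho \o c') 0) != 0 by rewrite Gc0.
  have dE := is_derive_inv (f := fun t => enorm ((gradient rho \o c') t)) ec0 (is_derive_enorm Gcn0 dGc).
  have dN : is_derive (0 : R^o) 1 (unit_gradient rho \o c') w.
    apply: is_derive_row => i.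
    have := is_deriveM_fun dE (is_derive_entry ord0 i dGc).
    rewrite (_ : (fun t => (unit_gradient rho \o c') t ord0 i) =
      (fun t => (enorm ((gradient rho \o c') t))^-1 * (gradient rho \o c') t ord0 i)); last first.
      by apply/funext => t; rewrite /unit_gradient /= mxE.
    rewrite Gc0 [w ord0 i]mxE => D; exact D.
  (* The outward normal is the normalized gradient at boundary points near [x], and the curve stays
     among these. *)
  apply: near_eq_is_derive dN.
  apply: filterS2 cb (curve_through_continuous cc' (defining_function_near dU)) => t bt dt.
  by rewrite /= (outward_normalE dt bt).
exact (@getPex _ [set w' | forall c' : R^o -> 'rV[R]_n,
  curve_through (boundary U) x v c' -> is_derive (0 : R^o) 1 (outward_normal U \o c') w']
  (ex_intro _ w Hw) c).
Qed.

(* Differentiate [outward_normal U (c t)] . [c' t] = 0 at 0. *)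
Lemma weingarten_acceleration U x (c c1 : R^o -> 'rV[R]_n) (c2 : 'rV[R]_n) :
  C2_boundary U -> boundary U x -> c 0 = x ->
  (\forall t \near (0 : R^o), boundary U (c t)) ->
  (\forall t \near (0 : R^o), is_derive (t : R^o) 1 c (c1 t)) ->
  is_derive (0 : R^o) 1 c1 c2 ->
  dot (weingarten U x (c1 0)) (c1 0) + dot (outward_normal U x) c2 = 0.
Proof.
move=> C2U bx c0 cb dc dc1.
have [rho C2r dU] := C2_boundary_defining C2U bx.
have dc0 := nbhs_singleton dc.
have cc : curve_through (boundary U) x (c1 0) c by [].
have dW := weingarten_is_derive C2r dU cc.
have orth : \forall t \near (0 : R^o), dot ((outward_normal U \o c) t) (c1 t) = 0.
  apply: filterS3 dc (near_join cb) (curve_through_continuous cc (defining_function_near dU)).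
  move=> t dct cbt dUt.
  rewrite /= (outward_normalE dUt (nbhs_singleton cbt)) /unit_gradient dotZl.
  by rewrite (tangent_gradient dUt dct cbt) mulr0.
have [_ H] := is_derive_dot dW dc1.
rewrite /= c0 in H; rewrite -H.
have orth0 : \forall t \near (0 : R^o), dot (outward_normal U (c t)) (c1 t) = cst 0 t.
  by [].
by rewrite (near_eq_derive (1 : R^o) orth0) derive_cst.
Qed.

End Normals.

(** * Consequences of minimality *)

Section PathLength.
Context {R : realType}.

(** The two inequations keep both norms away from their singularity at 0; the coordinates of the two
    points are continuous linear functions of [phi]. *)
Lemma C2_at_path_length (V : normedModType R) (p : 'rV[R]_3)
    (phi : V -> 'rV[R]_3 * 'rV[R]_3) (x : V) :
  C2_at phi x -> p != (phi x).1 -> (phi x).1 != (phi x).2 ->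
  C2_at (fun y => path_length p (phi y)) x.
Proof.
move=> cphi px xy.
have c1 i : C2_at (fun y => (phi y).1 ord0 i : R) x.
  apply: (@C2_at_lin R V _ R (fun z : 'rV[R]_3 * 'rV[R]_3 => z.1 ord0 i)) cphi.
    by move=> a u v; rewrite !mxE.
  move=> z; apply: (@continuous_comp _ _ _ fst (fun M : 'rV[R]_3 => M ord0 i)).
      exact: cvg_fst.
    exact: coord_continuous.
have c2 i : C2_at (fun y => (phi y).2 ord0 i : R) x.
  apply: (@C2_at_lin R V _ R (fun z : 'rV[R]_3 * 'rV[R]_3 => z.2 ord0 i)) cphi.
    by move=> a u v; rewrite !mxE.
  move=> z; apply: (@continuous_comp _ _ _ snd (fun M : 'rV[R]_3 => M ord0 i)).
      exact: cvg_snd.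
    exact: coord_continuous.
have cN (f : V -> R) : C2_at f x -> C2_at (fun y => -1 * f y) x.
  by move=> cf; exact (C2_atM (C2_at_cst (-1) x) cf).
have h1 : C2_at (fun y => enorm (p - (phi y).1)) x.
  apply: C2_at_enorm; first by rewrite subr_eq0.
  move=> i; rewrite (_ : (fun y => _) = (fun y => p ord0 i + -1 * (phi y).1 ord0 i)).
    exact (C2_atD (C2_at_cst _ x) (cN _ (c1 i))).
  by apply/funext => y; rewrite !mxE mulN1r.
have h2 : C2_at (fun y => enorm ((phi y).1 - (phi y).2)) x.
  apply: C2_at_enorm; first by rewrite subr_eq0.
  move=> i; rewrite (_ : (fun y => _) = (fun y => (phi y).1 ord0 i + -1 * (phi y).2 ord0 i)).
    exact (C2_atD (c1 i) (cN _ (c2 i))).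
  by apply/funext => y; rewrite !mxE mulN1r.
exact (C2_atD h1 h2).
Qed.

(** Applied both to a parametrization and to the length in it, to turn second derivatives into those
    of curves [t] to [phi (t *: u)]. *)
Lemma C2_at_line (V W : normedModType R) (phi : V -> W) (u : V) : C2_at phi 0 ->
  (\forall t \near (0 : R^o), is_derive (t : R^o) 1 (fun s : R^o => phi (s *: u))
     ('D_u phi (t *: u))) /\
  is_derive (0 : R^o) 1 (fun s : R^o => 'D_u phi (s *: u)) ('D_u (fun y => 'D_u phi y) 0).
Proof.
move=> [cphi dphi].
have line (X : normedModType R) (f : V -> X) (t : R) : C1_at f (t *: u) ->
    is_derive (t : R^o) 1 (fun s : R^o => f (s *: u)) ('D_u f (t *: u)).
  move=> cf; have := @is_derive_line R V X f 0 u t; rewrite add0r.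
  have [df _] := C1_at_derive u cf; move=> /(_ df).
  by rewrite (_ : (fun s : R^o => f (0 + _)) = (fun s : R^o => f (s *: u)))//;
    apply/funext => s; rewrite add0r.
split; last by have := line _ _ 0 _; rewrite scale0r; apply; exact: dphi.
have cl : {for (0 : R^o), continuous (fun t : R^o => t *: u)}.
  by apply: cvgZl; exact: cvg_id.
have near_line : \forall t \near (0 : R^o), C1_at phi (t *: u).
  by apply: cl; rewrite scale0r; exact: C1_at_near.
by apply: filterS near_line => t; exact: line.
Qed.

End PathLength.

(** * First-order conditions at [y0] and at [x0] *)

Section Reflection.
Context {R : realType} {n : nat}.
Implicit Types (x y p v : 'rV[R]_n).

(** Stationarity of the squared distance makes [y0 - x0] orthogonal to the tangent plane, hence a
    multiple [k] of the gradient. With [k < 0], a small step from [y0] towards [x0] would leave the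
    closure of [Omega], and the boundary would be met even closer to [x0]. *)
Lemma nearest_boundary_normal (Omega : set 'rV[R]_n) x0 y0 :
  C2_boundary Omega -> interior Omega x0 -> boundary Omega y0 -> y0 != x0 ->
  (forall y, boundary Omega y -> enorm (x0 - y0) <= enorm (x0 - y)) ->
  outward_normal Omega y0 = (enorm (y0 - x0))^-1 *: (y0 - x0) /\
  forall v, tangent_space (boundary Omega) y0 v -> dot (y0 - x0) v = 0.
Proof.
move=> C2O Ox0 by0 yx0 hmin; set Y := y0 - x0.
have [rho C2r dU] := C2_boundary_defining C2O by0; have [_ g0 _] := dU.
have r0 := proj1 (boundary_eq0 dU) by0.
set g := gradient rho y0 in g0.
have gg0 : 0 < dot g g by rewrite dot_gt0.
have Y0 : Y != 0 by rewrite subr_eq0.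
have tanY v : tangent_space (boundary Omega) y0 v -> dot Y v = 0.
  move=> [c [c0 cb dc]].
  have dm : is_derive (0 : R^o) 1 (fun t : R^o => c t - x0) v.
    by have := is_deriveB dc (is_derive_cst x0 (0 : R^o) (1 : R^o)); rewrite subr0; apply.
  have dd := is_derive_dot dm dm.
  have : dot v (c 0 - x0) + dot (c 0 - x0) v = 0.
    apply: (is_derive_local_min dd); apply: filterS cb => t /hmin.
    rewrite !(enormB x0) c0 -(ler_pXn2r (ltn0Sn 1)) ?nnegrE ?enorm_ge0//.
    by rewrite !enorm_sqr.
  by rewrite c0 (dotC v) -/Y; lra.
have E : Y = (dot Y g / dot g g) *: g.
  by apply: orthogonal_to_hyperplane => // v gv; apply: tanY; exact: gradient_tangent gv.
set k := _ / _ in E.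
have k0 : k != 0 by apply: contra_neq Y0 => k0; rewrite E k0 scale0r.
have kpos : 0 < k.
  rewrite lt_def k0 leNgt; apply/negP => kneg.
  have gY : 0 < dot g (- Y) by rewrite E dotNr dotZr oppr_gt0 nmulr_rlt0.
  have [t t0 [[/(_ t0) nclO _] t1]] :=
    near0_pos (filterI (defining_line dU r0 gY) near0_lt1).
  rewrite gtr0_norm// in t1.
  have [|tau /andP[tau0 tau1]] := @segment_meets_boundary _ _ Omega x0 (y0 + t *: - Y) Ox0.
    by move=> /interior_subset /subset_closure.
  move=> /hmin; apply/negP; rewrite -ltNge.
  (* The crossing point lies on the segment from [x0] to [y0], at the fraction [tau * (1 - t) < 1]
     of its length. *)
  have -> : x0 - (x0 + tau *: (y0 + t *: - Y - x0)) = (tau * (1 - t)) *: (x0 - y0).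
    by apply/rowP => i; rewrite !mxE; ring.
  rewrite enormZ gtr_pMl ?enorm_gt0 ?subr_eq0 1?eq_sym//.
  by rewrite ger0_norm ?mulr_ge0// ?subr_ge0 ?ltW//; nra.
split=> //; rewrite (outward_normalE dU by0) /unit_gradient -/g E enormZ gtr0_norm//.
rewrite scalerA; congr (_ *: _).
have e0 : enorm g != 0 by rewrite gt_eqF// enorm_gt0.
by field; rewrite e0 k0.
Qed.

(* The bisector of the unit vectors from [x0] to [p] and [y0] is a nonnegative
   multiple of the normal: otherwise the path would pass through D, and could be
   shortened at the exit point. *)
Lemma bisector_supports (D : set 'rV[R]_n) p x0 y0 :
  C2_boundary D -> strictly_convex D -> boundary D x0 -> ~ interior D p ->
  p != x0 -> y0 != x0 ->
  (forall x, boundary D x ->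
     enorm (p - x0) + enorm (x0 - y0) <= enorm (p - x) + enorm (x - y0)) ->
  dot (outward_normal D x0) (p - x0) <> 0 ->
  (forall x, closure D x ->
     dot ((enorm (p - x0))^-1 *: (p - x0) + (enorm (y0 - x0))^-1 *: (y0 - x0)) (x - x0) <= 0) /\
  exists2 g, dot g (y0 - x0) != 0 &
    forall v, tangent_space (boundary D) x0 v -> dot g v = 0.
Proof.
move=> C2D convD bx0 nDp px0 yx0 hmin ngraz.
have [rho C2r dU] := C2_boundary_defining C2D bx0; have [_ g0 _] := dU.
have r0 := proj1 (boundary_eq0 dU) bx0.
move: ngraz; rewrite (outward_normalE dU bx0) /unit_gradient.
set g := gradient rho x0 in g0 *.
set P := p - x0 in hmin *; set Y := y0 - x0; set r := enorm P in hmin *; set s := enorm Y.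
rewrite dotZl => /eqP; rewrite mulf_eq0 => /norP[_ gP].
have gg0 : 0 < dot g g by rewrite dot_gt0.
have rpos : 0 < r by rewrite enorm_gt0 subr_eq0.
have spos : 0 < s by rewrite enorm_gt0 subr_eq0.
have xys : enorm (x0 - y0) = s by rewrite enormB.
rewrite xys in hmin.
(* [A] and [B] are the unit vectors from [x0] to [p] and to [y0], kept opaque so that they act as
   atoms in the algebra below. *)
have [A AE] : exists A, A = r^-1 *: P by eexists.
have [B BE] : exists B, B = s^-1 *: Y by eexists.
have AA : dot A A = 1 by rewrite AE dotZl dotZr -enorm_sqr -/r; field; rewrite gt_eqF.
have BB : dot B B = 1 by rewrite BE dotZl dotZr -enorm_sqr -/s; field; rewrite gt_eqF.
have PE : P = r *: A by rewrite AE scalerA divff ?scale1r// gt_eqF.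
have YE : Y = s *: B by rewrite BE scalerA divff ?scale1r// gt_eqF.
have tanW v : tangent_space (boundary D) x0 v -> dot (A + B) v = 0.
  move=> [c [c0 cb dc]].
  have d1 : is_derive (0 : R^o) 1 (fun t : R^o => p - c t) (- v).
    by have := is_deriveB (is_derive_cst p (0 : R^o) (1 : R^o)) dc; rewrite sub0r; apply.
  have d2 : is_derive (0 : R^o) 1 (fun t : R^o => c t - y0) v.
    by have := is_deriveB dc (is_derive_cst y0 (0 : R^o) (1 : R^o)); rewrite subr0; apply.
  have n1 : p - c 0 != 0 by rewrite c0 subr_eq0.
  have n2 : c 0 - y0 != 0 by rewrite c0 subr_eq0 eq_sym.
  have dd := is_deriveD_fun (is_derive_enorm (F := fun t : R^o => p - c t) n1 d1)
    (is_derive_enorm (F := fun t : R^o => c t - y0) n2 d2).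
  have : dot (p - c 0) (- v) / enorm (p - c 0) + dot (c 0 - y0) v / enorm (c 0 - y0) = 0.
    apply: (is_derive_local_min dd); apply: filterS cb => t /hmin.
    by rewrite c0 xys.
  rewrite c0 xys -/P -/r -(opprB y0 x0) -/Y dotNr dotNl => H.
  by rewrite AE BE dotDl !dotZl -[RHS]oppr0 -H; field; rewrite !gt_eqF.
have E : A + B = (dot (A + B) g / dot g g) *: g.
  by apply: orthogonal_to_hyperplane => // v gv; apply: tanW; exact: gradient_tangent gv.
set k := _ / _ in E.
have gA : dot g A != 0 by rewrite AE dotZr mulf_neq0// invr_neq0// gt_eqF.
have BgA : B = k *: g - A by rewrite -E addrC addKr.
have gB : dot g B = k * dot g g - dot g A by rewrite BgA dotDr dotNr dotZr.
(* Both [A] and [B = k g - A] are unit vectors. The root [k = 0] is the straight path [B = - A], the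
   other root is the law of reflection. *)
have kk : k * (k * dot g g - 2 * dot g A) = 0.
  have : dot B B = k ^+ 2 * dot g g - 2 * k * dot g A + dot A A.
    by rewrite BgA !dotE (dotC A g); ring.
  by rewrite AA BB => H; nra.
(* For [x] strictly beyond the tangent plane, points of the segment close to [x0] would lie off the
   closure of [D], against strict convexity. *)
have support x : closure D x -> dot g (x - x0) <= 0.
  move=> Dx; rewrite leNgt; apply/negP => gx.
  have [xx0|/eqP xx0] := eqVneq x x0.
    by move: gx; rewrite xx0 subrr dotC dot0l ltxx.
  have [t t0 [[/(_ t0) nclD _] t1]] :=
    near0_pos (filterI (defining_line dU r0 gx) near0_lt1).
  rewrite gtr0_norm// in t1.
  apply: nclD; apply: subset_closure; apply: interior_subset.
  have -> : x0 + t *: (x - x0) = t *: x + (1 - t) *: x0.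
    by apply/rowP => i; rewrite !mxE; ring.
  by apply: convD => //; [case: bx0 | rewrite t0].
(* A negative [k] is the reflection root with [g . A < 0]: the segment from [x0] to [p] starts
   inside [D] and leaves it at some [x0 + th P]. Comparing with the path through that point forces
   [A . B <= -1], hence [A + B = 0], whereas [A + B = k g] is nonzero. *)
have k0 : 0 <= k.
  rewrite leNgt; apply/negP => kneg.
  have kg : k * dot g g = 2 * dot g A.
    by move/eqP: kk; rewrite mulf_eq0 lt_eqF//= subr_eq0 => /eqP.
  have gnP : 0 < dot g (- P).
    have : k * dot g g < 0 by rewrite nmulr_rlt0.
    by rewrite kg PE dotNr dotZr oppr_gt0 pmulr_rlt0// pmulr_rlt0.
  have [t t0 [[_ /(_ t0) Dt] t1]] :=
    near0_neg (filterI (defining_line dU r0 gnP) near0_lt1).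
  rewrite ltr0_norm// in t1.
  have [tau /andP[tau0 tau1] /hmin] := segment_meets_boundary Dt nDp.
  pose th := - t + tau * (1 + t).
  have th0 : 0 < th by rewrite /th; nra.
  have th1 : th <= 1 by rewrite /th; nra.
  have -> : p - (x0 + t *: - P + tau *: (p - (x0 + t *: - P))) = (1 - th) *: P.
    by apply/rowP => i; rewrite /th !mxE; ring.
  have -> : x0 + t *: - P + tau *: (p - (x0 + t *: - P)) - y0 = th *: P - Y.
    by apply/rowP => i; rewrite /th !mxE; ring.
  rewrite enormZ ger0_norm ?subr_ge0// -/r => H.
  have sq : (s + th * r) ^+ 2 <= dot (th *: P - Y) (th *: P - Y).
    have le : s + th * r <= enorm (th *: P - Y) by lra.
    have ge0 : 0 <= s + th * r by rewrite addr_ge0 ?mulr_ge0// ltW.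
    by rewrite -enorm_sqr lerXn2r// nnegrE enorm_ge0.
  have AB : dot A B <= -1.
    move: sq; rewrite PE YE !dotE AA BB (dotC B A) => sq.
    have : (th * r * s) * (dot A B + 1) <= 0 by nra.
    by rewrite pmulr_rle0 ?mulr_gt0//; lra.
  have : dot (A + B) (A + B) <= 0 by rewrite !dotE AA BB (dotC B A); lra.
  rewrite E dotZl dotZr mulrA pmulr_lle0//; nra.
split=> [x /support gx|].
  by rewrite -AE -BE E dotZl mulr_ge0_le0.
(* In the two cases for [k], [g . B] is [- g . A] or [g . A], which is nonzero because the path does
   not graze. *)
exists g => [|v [c [c0 cb dc]]].
  rewrite YE dotZr mulf_eq0 negb_or gt_eqF//= gB.
  apply: contra_neq gA => gAk; move/eqP: kk; rewrite mulf_eq0 => /orP[] /eqP kE.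
    by move: gAk; rewrite kE mul0r => ?; lra.
  by lra.
by rewrite /g -c0; apply: (tangent_gradient _ dc cb); rewrite c0.
Qed.

End Reflection.

(** * Second variation of the length *)

Section SecondVariation.
Context {R : realType}.
Implicit Types (a b e q : 'rV[R]_3).

(** Both differences are reversed with respect to [path_length], so that [u] and [w] point along the
    path. The first derivative [l1] is left existential because only its derivative at 0 matters
    afterwards. *)
Lemma second_derive_path_length q (c c1 : R^o -> 'rV[R]_3 * 'rV[R]_3)
    (c2 : 'rV[R]_3 * 'rV[R]_3) :
  (\forall t \near (0 : R^o), is_derive (t : R^o) 1 c (c1 t)) ->
  is_derive (0 : R^o) 1 c1 c2 -> q != (c 0).1 -> (c 0).1 != (c 0).2 ->
  let u := (c 0).1 - q in let w := (c 0).2 - (c 0).1 in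
  let du := (c1 0).1 in let dw := (c1 0).2 - (c1 0).1 in
  exists2 l1 : R -> R,
    \forall t \near (0 : R), is_derive (t : R^o) 1 (fun s : R^o => path_length q (c s)) (l1 t) &
    is_derive (0 : R^o) 1 (l1 : R^o -> R)
      (((dot du du + dot u c2.1) / enorm u - dot u du ^+ 2 / enorm u ^+ 3) +
       ((dot dw dw + dot w (c2.2 - c2.1)) / enorm w - dot w dw ^+ 2 / enorm w ^+ 3)).
Proof.
move=> dc dc1 qx xy u w du dw.
have dfst (f : R^o -> 'rV[R]_3 * 'rV[R]_3) t df : is_derive (t : R^o) 1 f df ->
    is_derive (t : R^o) 1 (fun s : R^o => (f s).1) df.1.
  by apply: is_derive_lin => // z; exact: cvg_fst.
have dsnd (f : R^o -> 'rV[R]_3 * 'rV[R]_3) t df : is_derive (t : R^o) 1 f df ->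
    is_derive (t : R^o) 1 (fun s : R^o => (f s).2) df.2.
  by apply: is_derive_lin => // z; exact: cvg_snd.
have du_ t : is_derive (t : R^o) 1 c (c1 t) ->
    is_derive (t : R^o) 1 (fun s : R^o => (c s).1 - q) (c1 t).1.
  by move=> /dfst d; have := is_deriveB d (is_derive_cst q (t : R^o) (1 : R^o)); rewrite subr0; apply.
have dw_ (f : R^o -> 'rV[R]_3 * 'rV[R]_3) t df : is_derive (t : R^o) 1 f df ->
    is_derive (t : R^o) 1 (fun s : R^o => (f s).2 - (f s).1) (df.2 - df.1).
  by move=> d; exact (is_deriveB (dsnd _ _ _ d) (dfst _ _ _ d)).
have u0 : u != 0 by rewrite subr_eq0 eq_sym.
have w0 : w != 0 by rewrite subr_eq0 eq_sym.
have dc0 := nbhs_singleton dc.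
exists (fun t : R => dot ((c t).1 - q) (c1 t).1 / enorm ((c t).1 - q)
      + dot ((c t).2 - (c t).1) ((c1 t).2 - (c1 t).1) / enorm ((c t).2 - (c t).1)).
  have near_neq (f : R^o -> 'rV[R]_3) df : is_derive (0 : R^o) 1 f df -> f 0 != 0 ->
      \forall t \near (0 : R^o), f t != 0.
    move=> [df0 _] f0; have cf : {for (0 : R^o), continuous f}.
      by apply: differentiable_continuous; apply/derivable1_diffP.
    exact (cvgr_neq0 _ cf f0).
  apply: filterS3 dc (near_neq _ _ (du_ _ dc0) u0) (near_neq _ _ (dw_ _ _ _ dc0) w0).
  move=> t dct ut wt.
  rewrite (_ : (fun s : R^o => _) =
    (fun s : R^o => enorm ((c s).1 - q) + enorm ((c s).2 - (c s).1))); last first.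
    by apply/funext => s; rewrite /path_length (enormB q) (enormB (c s).1 (c s).2).
  exact (is_deriveD_fun (is_derive_enorm (F := fun s : R^o => (c s).1 - q) ut (du_ _ dct))
    (is_derive_enorm (F := fun s : R^o => (c s).2 - (c s).1) wt (dw_ _ _ _ dct))).
exact (is_deriveD_fun
  (second_derive_enorm (c := fun s : R^o => (c s).1 - q) (c1 := fun s : R^o => (c1 s).1)
     u0 (du_ _ dc0) (dfst _ _ _ dc1))
  (second_derive_enorm (c := fun s : R^o => (c s).2 - (c s).1)
     (c1 := fun s : R^o => (c1 s).2 - (c1 s).1) w0 (dw_ _ _ _ dc0) (dw_ _ _ _ dc1))).
Qed.

Lemma dot_orthogonal_part e a : dot e e = 1 ->
  dot (a - dot e a *: e) (a - dot e a *: e) = dot a a - dot e a ^+ 2.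
Proof. by move=> ee; rewrite !dotE ee (dotC a e); ring. Qed.

(* The form |v|^2 - (e.v)^2 is nonnegative at v = (r + s) a - r b. *)
Lemma parallel_sum_le e a b (r s : R) : dot e e = 1 -> dot e b = 0 -> 0 < r -> 0 < s ->
  dot b b / (r + s) <= (dot a a - dot e a ^+ 2) / r
    + (dot (b - a) (b - a) - dot e (b - a) ^+ 2) / s.
Proof.
move=> ee eb r0 s0; pose d := (r + s) *: a - r *: b.
have := dot_ge0 (d - dot e d *: e); rewrite dot_orthogonal_part// => Q0.
rewrite -subr_ge0.
have -> : (dot a a - dot e a ^+ 2) / r + (dot (b - a) (b - a) - dot e (b - a) ^+ 2) / s
    - dot b b / (r + s) = (dot d d - dot e d ^+ 2) / (r * s * (r + s)).
  by rewrite /d !dotE eb (dotC b a); field; rewrite !gt_eqF ?addr_gt0.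
by rewrite divr_ge0// !mulr_ge0 ?addr_ge0// ltW.
Qed.

(** Here [k] stands for the Weingarten form at [b] and [g] for a normal of the inner surface. The
    terms in [a2] cancel since both segments have direction [e]. For [b = 0], the sum could vanish
    only if [a] were a multiple of [e]; then [g . a = 0] and [g . e != 0] would give [a = 0]. *)
Lemma second_variation_gt0 (e g a b a2 b2 : 'rV[R]_3) (r s k : R) :
  dot e e = 1 -> 0 < r -> 0 < s -> dot e b = 0 ->
  dot g a = 0 -> dot g e != 0 -> (a, b) != 0 ->
  dot e b2 = - k -> (b = 0 -> k = 0) -> (b != 0 -> k < dot b b / (r + s)) ->
  0 < (dot a a + dot (r *: e) a2) / r - dot (r *: e) a ^+ 2 / r ^+ 3 +
      ((dot (b - a) (b - a) + dot (s *: e) (b2 - a2)) / s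
        - dot (s *: e) (b - a) ^+ 2 / s ^+ 3).
Proof.
move=> ee r0 s0 eb ga ge ab eb2 k0 kb.
have -> : (dot a a + dot (r *: e) a2) / r - dot (r *: e) a ^+ 2 / r ^+ 3 +
      ((dot (b - a) (b - a) + dot (s *: e) (b2 - a2)) / s
        - dot (s *: e) (b - a) ^+ 2 / s ^+ 3) =
    (dot a a - dot e a ^+ 2) / r + (dot (b - a) (b - a) - dot e (b - a) ^+ 2) / s - k.
  rewrite !dotZl !dotDr !dotNr eb2; field.
  by rewrite !gt_eqF.
have [b0|b0] := eqVneq b 0; last first.
  by rewrite subr_gt0; apply: lt_le_trans (kb b0) _; exact: parallel_sum_le.
have a0 : a != 0 by apply: contraNneq ab => ->; rewrite b0.
rewrite b0 k0// !sub0r dotNl !dotNr opprK sqrrN subr0.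
suff Q : 0 < dot a a - dot e a ^+ 2 by rewrite addr_gt0// divr_gt0.
rewrite -dot_orthogonal_part// dot_gt0 subr_eq0; apply: contra_neq a0 => aE.
move: ga; rewrite aE dotZr => /eqP; rewrite mulf_eq0 (negbTE ge) orbF => /eqP ->.
by rewrite scale0r.
Qed.

End SecondVariation.

(** * Non-degeneracy, by comparison of the lengths from [p] and from [p'] *)

Theorem proposition6p1 (R : realType) (Omega D : set 'rV[R]_3)
    (p x0 y0 : 'rV[R]_3)
    (Omega_nonempty : Omega !=set0) (Omega_open : open Omega)
    (Omega_connected : connected Omega) (Omega_bounded : bounded_set Omega)
    (Omega_C2 : C2_boundary Omega)
    (D_open : open D) (D_C2 : C2_boundary D)
    (D_inside : closure D `<=` Omega)
    (Omega_minus_D_connected : connected (Omega `\` closure D))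
    (p_outside : ~ closure Omega p)
    (D_strictly_convex : strictly_convex D)
    (x0y0_shortest :
       (shortest_paths Omega D p `\` grazing_paths Omega D p) (x0, y0))
    (curvature_bound : weingarten_lt Omega y0 (1 / shortest_length Omega D p)) :
  nondegenerate_critical_point 3 (boundary D `*` boundary Omega)
    (path_length p) (x0, y0).
Proof.
have [[[bx0 by0] plE] ngraz] := x0y0_shortest; rewrite /= in bx0 by0.
have OI : interior Omega = Omega by apply/interior_id.
have Ox0 : Omega x0 by apply: D_inside; case: bx0.
have nOy0 : ~ Omega y0 by rewrite -OI; case: by0.
have yx : y0 != x0 by apply/eqP => E; apply: nOy0; rewrite E.
have nDp : ~ closure D p.
  by move=> /D_inside Op; apply: p_outside; exact: subset_closure.
have px : p != x0 by apply/eqP => E; apply: p_outside; rewrite E; exact: subset_closure.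
have plmin z : boundary D z.1 -> boundary Omega z.2 ->
    path_length p (x0, y0) <= path_length p z.
  move=> z1 z2; rewrite plE; apply: ge_inf; last by exists z.
  by exists 0 => _ [y _ <-]; rewrite addr_ge0 ?enorm_ge0.
have [nuE tanY] : outward_normal Omega y0 = (enorm (y0 - x0))^-1 *: (y0 - x0) /\
    forall v, tangent_space (boundary Omega) y0 v -> dot (y0 - x0) v = 0.
  apply: nearest_boundary_normal => //; first by rewrite OI.
  by move=> y yb; have := plmin (x0, y) bx0 yb; rewrite /path_length/= lerD2l.
have [supp [g gY tanX]] : (forall x, closure D x ->
     dot ((enorm (p - x0))^-1 *: (p - x0) + (enorm (y0 - x0))^-1 *: (y0 - x0)) (x - x0) <= 0) /\
  exists2 g, dot g (y0 - x0) != 0 &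
    forall v, tangent_space (boundary D) x0 v -> dot g v = 0.
  apply: bisector_supports => //.
  - by move=> /interior_subset /subset_closure.
  - by move=> x xb; have := plmin (x, y0) xb by0.
  - by move=> E; apply: ngraz; split.
set P := p - x0 in supp; set Y := y0 - x0 in nuE tanY supp gY.
have r0 : 0 < enorm P by rewrite enorm_gt0 subr_eq0.
have s0 : 0 < enorm Y by rewrite enorm_gt0 subr_eq0.
set r := enorm P in supp r0; set s := enorm Y in nuE supp s0.
have lE : shortest_length Omega D p = r + s.
  by rewrite -plE /path_length/= -/P -/r enormB.
have [e eE] : exists e, e = s^-1 *: Y by eexists.
have YE : Y = s *: e by rewrite eE scalerA divff ?scale1r// gt_eqF.
have ee : dot e e = 1 by rewrite eE dotZl dotZr -enorm_sqr -/s; field; rewrite gt_eqF.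
pose p' := x0 - r *: e.
have x0p' : x0 - p' = r *: e by rewrite /p' opprB addrC subrK.
(* With [A] the unit vector from [x0] to [p] and [d = x - x0], the squared distances differ by
   [- 2 r (A + e) . d], which is nonnegative by [supp]. *)
have closer x : closure D x -> enorm (p' - x) <= enorm (p - x).
  move=> /supp; rewrite -eE => H; rewrite -ler_sqr ?nnegrE ?enorm_ge0// !enorm_sqr.
  have -> : p' - x = - (r *: e + (x - x0)).
    by apply/rowP => i; rewrite !mxE; ring.
  have PE : P = r *: (r^-1 *: P) by rewrite scalerA divff ?scale1r// gt_eqF.
  have PP : dot (r^-1 *: P) (r^-1 *: P) = 1.
    by rewrite dotZl dotZr -enorm_sqr -/r; field; rewrite gt_eqF.
  have -> : p - x = r *: (r^-1 *: P) - (x - x0).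
    by rewrite -PE /P; apply/rowP => i; rewrite !mxE; ring.
  move: PP H; move: (r^-1 *: P) (x - x0) => A d AA.
  by rewrite !dotE AA ee (dotC d e) (dotC d A) => H; nra.
split; first by split.
move=> phi [phi0 C2phi inj phiM _] gg.
have C2g : C2_at gg 0.
  apply: (C2_at_path_length C2phi); rewrite phi0//=.
  by rewrite eq_sym.
(* The product of the two surfaces has dimension 4, which is [k.+1] for the argument 3 of
   [nondegenerate_critical_point]. *)
have gmin : \forall u \near (0 : 'rV[R]_4), gg 0 <= gg u.
  by apply: filterS phiM => u [b1 b2]; rewrite /gg /= phi0; exact: plmin.
have along u := C2_at_line u C2g.
have crit u : 'D_u gg 0 = 0.
  have [/nbhs_singleton d _] := along u; rewrite scale0r in d.
  apply: (is_derive_local_min d); rewrite scale0r.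
  have := near_line u gmin; apply: filterS => t; rewrite add0r.
  exact.
split=> // u Hu; apply/eqP; apply: contraT => u0.
(* For [u] in the radical, only the diagonal value of the Hessian at [(u, u)] is used: it vanishes,
   and this is to be refuted for [u != 0]. *)
have [dgg dgg1] := along u; rewrite Hu in dgg1.
have [dc dc1] := C2_at_line u C2phi.
set c := fun t : R^o => phi (t *: u) in dc.
have phi0' : phi (0 *: u) = (x0, y0) by rewrite scale0r phi0.
have cM : \forall t \near (0 : R^o), boundary D (c t).1 /\ boundary Omega (c t).2.
  have := near_line u phiM; apply: filterS => t; rewrite add0r.
  by move=> [].
have qx : p' != (c 0).1.
  rewrite /c phi0' /= eq_sym -subr_eq0 x0p' -enorm_gt0 enormZ.
  by rewrite mulr_gt0 ?normr_gt0 ?gt_eqF// enorm_gt0 -dot_gt0 ee.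
have xy : (c 0).1 != (c 0).2 by rewrite /c phi0' /= eq_sym.
have [l1 dl1 dl2] := second_derive_path_length dc dc1 qx xy.
pose c1 := fun t : R^o => 'D_u phi (t *: u).
have dfst t : is_derive (t : R^o) 1 c (c1 t) ->
    is_derive (t : R^o) 1 (fun s : R^o => (c s).1) (c1 t).1.
  by apply: is_derive_lin => // z; exact: cvg_fst.
have dsnd (f : R^o -> 'rV[R]_3 * 'rV[R]_3) t df : is_derive (t : R^o) 1 f df ->
    is_derive (t : R^o) 1 (fun s : R^o => (f s).2) df.2.
  by apply: is_derive_lin => // z; exact: cvg_snd.
have tana : tangent_space (boundary D) x0 (c1 0).1.
  exists (fun t : R^o => (c t).1); split; first by rewrite /c phi0'.
    by apply: filterS cM => t [].
  exact: dfst (nbhs_singleton dc).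
have tanb : tangent_space (boundary Omega) y0 (c1 0).2.
  exists (fun t : R^o => (c t).2); split; first by rewrite /c phi0'.
    by apply: filterS cM => t [].
  exact: dsnd (nbhs_singleton dc).
have acc : dot (weingarten Omega y0 (c1 0).2) (c1 0).2 +
    dot (outward_normal Omega y0) ('D_u (fun y => 'D_u phi y) 0).2 = 0.
  apply: (@weingarten_acceleration _ _ Omega y0 (fun t : R^o => (c t).2)
    (fun t : R^o => (c1 t).2)) => //.
  - by rewrite /c phi0'.
  - by apply: filterS cM => t [].
  - by apply: filterS dc => t; exact: dsnd.
(* The parametrization is an immersion, so the velocity of the curve is nonzero. *)
have ab0 : ((c1 0).1, (c1 0).2) != 0.
  apply: contra_neq u0; rewrite -surjective_pairing /c1 scale0r; exact: inj.
have := @second_variation_gt0 R e g (c1 0).1 (c1 0).2 ('D_u (fun y => 'D_u phi y) 0).1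
  ('D_u (fun y => 'D_u phi y) 0).2 r s (dot (weingarten Omega y0 (c1 0).2) (c1 0).2)
  ee r0 s0 _ (tanX _ tana) _ ab0.
have /= uE : (c 0).1 - p' = r *: e by rewrite /c phi0'.
have /= wE : (c 0).2 - (c 0).1 = s *: e by rewrite /c phi0' -YE.
rewrite uE wE in dl2.
have enorm_e k : 0 < k -> enorm (k *: e) = k.
  by move=> k0; rewrite enormZ gtr0_norm// /enorm ee sqrtr1 mulr1.
rewrite !enorm_e// in dl2.
move: dl2; set G2 := (X in is_derive _ _ _ X) => dl2 G2pos.
(* Along the curve, the length from [p] minus the length from [p'] is minimal at 0 by [closer]. Its
   second derivative there is [0 - G2], which would then be nonnegative. *)
suff : 0 < G2.
  have dh : \forall t \near (0 : R), is_derive (t : R^o) 1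
      (fun s : R^o => path_length p (c s) - path_length p' (c s)) ('D_u gg (t *: u) - l1 t).
    by apply: filterS2 dgg dl1 => t d1 d2; exact (is_deriveB d1 d2).
  have dh1 : is_derive (0 : R^o) 1 (fun t : R^o => 'D_u gg (t *: u) - l1 t) (0 - G2).
    exact (is_deriveB dgg1 dl2).
  have : 0 <= 0 - G2.
    apply: (second_derive_local_min dh dh1); apply: filterS cM => t [/= b1 _].
    have c0E : c 0 = (x0, y0) by rewrite /c phi0'.
    rewrite c0E /path_length/= -/P -/r (enormB p' x0) x0p' enorm_e// subrr subr_ge0 lerD2r.
    by apply: closer; case: b1.
  by rewrite sub0r oppr_ge0 leNgt => /negP.
apply: G2pos.
- by rewrite eE dotZl tanY// mulr0.
- by rewrite eE dotZr mulf_neq0// invr_neq0// gt_eqF.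
(* As [e] is the outward normal at [y0], [acc] identifies [e . b2] with minus the Weingarten
   form. *)
- by rewrite eE -nuE; apply/eqP; rewrite -addr_eq0 addrC; apply/eqP; exact acc.
- by move=> ->; rewrite dotC dot0l.
- move=> b0; have := curvature_bound _ tanb (elimN eqP b0).
  by rewrite lE mul1r mulrC.
Qed.
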